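(* If $\Omega \in \mathcal{S}^2$ is weakly convex, then for any integer $k \ge 1$ $$c_k(\Omega) = \min_{0 \le j \le k} \Big( \max_{p \in \Omega} A_{j,k-j}(p) \Big).$$
   Context: All vector spaces and homology groups are over $\mathbb{Q}$. **Domains.** Let $\Sigma^2 := \{v \in (\mathbb{R}_{\ge 0})^2 \mid |v|=1\}$. $\mathcal{S}^2$ is the set of all $\Omega \subset (\mathbb{R}_{\ge 0})^2$ for which there is $r_\Omega \in C^\infty(\Sigma^2, \mathbb{R}_{>0})$ with $\Omega = \{ tz \mid 0 \le t \le r_\Omega(z),\ z \in \Sigma^2\}$. Put $U_\Omega := (\mathbb{R}_{>0})^2 \setminus \Omega$. $\Omega$ is called weakly convex if it is a convex subset of $\mathbb{R}^2$. **Chain complex.** Let $I := \mathbb{Z}^2 \setminus (\mathbb{Z}_{\le 0})^2$ and $S^1 = \mathbb{R}/\mathbb{Z}$. Let $e_0 \in H_0(S^1)$ be the class of a point and $e_1 \in H_1(S^1)$ the class of $[0,1] \to S^1$, $t \mapsto [t]$. Define the $\mathbb{Z}$-graded vector space $$C^\Omega_* := \bigoplus_{(m_1,m_2) \in I} C^{\mathrm{sing}}_{*+1-2(m_1+m_2)}(U_\Omega) \otimes H_*(S^1),$$ where $C^{\mathrm{sing}}_*$ is the singular chain complex; i.e. for a singular $i$-chain $\sigma$, the element $\sigma \otimes e_j$ in the $(m_1,m_2)$-summand has degree $2(m_1+m_2)-1+i+j$. Write $x = \sum_{(m_1,m_2) \in I,\, i \in \{0,1\}} x_{m_1,m_2,i}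 \otimes e_i$. For homogeneous $x$ of degree $|x|$, the boundary operator is $$(\partial x)_{m_1,m_2,0} = \partial^{\mathrm{sing}} x_{m_1,m_2,0}, \qquad (\partial x)_{m_1,m_2,1} = \partial^{\mathrm{sing}} x_{m_1,m_2,1} + (-1)^{|x|}\big(m_2\, x_{m_1+1,m_2,0} - m_1\, x_{m_1,m_2+1,0}\big)$$ for $(m_1,m_2)\in I$. **Filtration.** Let $A_{m_1,m_2}(y_1,y_2) := m_1 y_1 + m_2 y_2$. For $a \in \mathbb{R}$ let $U_\Omega(a:m_1,m_2) := \{ y \in U_\Omega \mid A_{m_1,m_2}(y) < a\}$. Let $C^{\Omega,a}_* \subset C^\Omega_*$ be the subcomplex obtained by replacing $U_\Omega$ by $U_\Omega(a:m_1,m_2)$ in the $(m_1,m_2)$-summand, and $C^{\Omega,\infty}_* := C^\Omega_*$. For $-\infty<a<b\le\infty$ put $C^{\Omega,[a,b)}_* := C^{\Omega,b}_*/C^{\Omega,a}_*$. **Capacities.** For $0<a\le\infty$ let $H^{+,a}_*(\Omega) := \varprojlim_{\delta \to 0+} H_*(C^{\Omega,[\delta,a)})$, the inverse limit along the natural maps induced by $C^{\Omega,[\delta,a)}_* \to C^{\Omega,[\delta',a)}_*$ for $\delta \le \delta'$. For $a>0$ let $(i^a_\Omega)_*: H^{+,a}_*(\Omega) \to H^{+,\infty}_*(\Omega)$ be the natural map. For an integer $k \ge 1$, $$c_k(\Omega) := \inf\{ a>0 \mid (i^a_\Omega)_{2k+1} \ne 0\}.$$ *)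

(* Defs.v *)
From HB Require Import structures.
From mathcomp Require Import all_boot all_order all_algebra.
From mathcomp Require Import all_classical all_reals all_analysis.
From mathcomp.multinomials Require Import freeg.

Import Order.TTheory GRing.Theory Num.Theory.
Import numFieldNormedType.Exports.

Local Open Scope classical_set_scope.
Local Open Scope ring_scope.

(* The norm is Euclidean; the library norm of R * R is the max norm. *)
Definition quarter_circle {R : realType} : set (R * R) :=
  [set z | [/\ 0 <= z.1, 0 <= z.2 & z.1 ^+ 2 + z.2 ^+ 2 = 1]].

(* Smoothness on the arc, a manifold with boundary, is read in the chart given
   by the angle in [0, pi / 2]; there, a function is smooth when it is the
   restriction of a smooth function on the line. *)
Definition smooth_on_quarter_circle {R : realType} (r : R * R -> R) : Prop :=
  exists g : R -> R,
    (forall (n : nat) (x : R), derivable (derive1n n g) x 1) /\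
    (forall x : R, 0 <= x <= pi / 2 -> r (cos x, sin x) = g x).

Definition star_domain {R : realType} (Omega : set (R * R)) : Prop :=
  exists r : R * R -> R,
    [/\ smooth_on_quarter_circle r,
        forall z, quarter_circle z -> 0 < r z
      & Omega = [set p | exists z t, [/\ quarter_circle z, 0 <= t <= r z
                                       & p = (t * z.1, t * z.2)]]].

Definition weakly_convex {R : realType} (Omega : set (R * R)) : Prop :=
  @convex_set R (R^o * R^o)%type Omega.

Definition open_complement {R : realType} (Omega : set (R * R)) :
    set (R * R) :=
  [set y | [/\ 0 < y.1, 0 < y.2 & ~ Omega y]].

Definition std_simplex (R : realType) (n : nat) : set 'rV[R]_n.+1 :=
  [set t | (forall j, 0 <= t ord0 j) /\ \sum_j t ord0 j = 1].

Definition insert0 {R : realType} {n : nat} (i : 'I_n.+2) (t : 'rV[R]_n.+1) :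
    'rV[R]_n.+2 :=
  \row_j (if unlift i j is Some j' then t ord0 j' else 0).

Lemma insert0_simplex {R : realType} {n : nat} (i : 'I_n.+2)
    (t : std_simplex R n) :
  insert0 i (set_val t) \in std_simplex R n.+1.
Proof.
have /set_mem[t0 t1] := valP t; apply/mem_set; split.
  by move=> j; rewrite mxE; case: unliftP.
rewrite (bigD1 i)//= mxE unlift_none add0r -[RHS]t1.
rewrite (reindex_onto (fintype.lift i) (fun j => odflt ord0 (unlift i j)))/=;
  last first.
  by move=> j; case: unliftP => [j' ->//|->]; rewrite eqxx.
apply: eq_big => [j|j _]; first by rewrite liftK !eqxx andbT eq_sym neq_lift.
by rewrite mxE liftK.
Qed.

Definition face {R : realType} {n : nat} (i : 'I_n.+2)
    (t : std_simplex R n) : std_simplex R n.+1 :=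
  exist _ (insert0 i (set_val t)) (insert0_simplex i t).

Lemma continuous_insert0 {R : realType} {n : nat} (i : 'I_n.+2) :
  continuous (@insert0 R n i).
Proof.
move=> t; have FF : Filter (nbhs t) by exact: nbhs_filter.
apply/(@cvg_ballP _ _ _ _ FF) => e e0.
near=> u; have [_ tu] : ball t e u by near: u; exact: nbhsx_ballx.
split=> // k j; rewrite (ord1 k) !mxE.
by case: unliftP => [j' _|_]; [exact: tu|exact: ballxx].
Unshelve. all: by end_near. Qed.

Lemma continuous_face {R : realType} {n : nat} (i : 'I_n.+2) :
  continuous (@face R n i).
Proof.
apply: (@continuous_comp_initial _ _ _ set_val) => t.
apply: (@continuous_comp _ _ _ set_val (insert0 i)).
  exact: initial_continuous.
exact: continuous_insert0.
Qed.

HB.instance Definition _ (R : realType) (n : nat) (i : 'I_n.+2) :=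
  @isContinuous.Build _ _ (@face R n i) (@continuous_face R n i).

Definition sing_simplex (R : realType) : Type :=
  {n : nat & continuousType (std_simplex R n) (R * R)%type}.
HB.instance Definition _ (R : realType) := Choice.on (sing_simplex R).

(* Singular chains of all dimensions, i.e. the direct sum over n of the
   vector spaces of singular n-chains of the plane. *)
Definition sing_chain (R : realType) : Type := {freeg (sing_simplex R) / rat}.
HB.instance Definition _ (R : realType) := GRing.Lmodule.on (sing_chain R).

Definition sing_face {R : realType} {n : nat}
    (s : continuousType (std_simplex R n.+1) (R * R)%type) (i : 'I_n.+2) :
    sing_simplex R :=
  existT _ n (s \o @face R n i : continuousType _ _).

Definition sing_simplex_bd {R : realType} (s : sing_simplex R) :
    sing_chain R :=
  match s with
  | existT 0%N _ => 0
  | existT n.+1 s' => \sum_(i < n.+2) (-1) ^+ i *: << sing_face s' i >>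
  end.

Definition sing_bd {R : realType} : sing_chain R -> sing_chain R :=
  fglift sing_simplex_bd.

(* The n-chains of the subspace U, as a subspace of the chains of the plane;
   zero for n < 0. *)
Definition chains_in {R : realType} (U : set (R * R)) (n : int) :
    set (sing_chain R) :=
  [set c | forall s : sing_simplex R, s \in dom c ->
     (projT1 s)%:Z = n /\ range (projT2 s) `<=` U].

Definition index_set (m : int * int) : bool := ~~ ((m.1 <= 0) && (m.2 <= 0)).

Definition A_form {R : realType} (m1 m2 : int) (y : R * R) : R :=
  m1%:~R * y.1 + m2%:~R * y.2.

Definition sublevel {R : realType} (Omega : set (R * R)) (a : \bar R)
    (m : int * int) : set (R * R) :=
  [set y | open_complement Omega y /\ ((A_form m.1 m.2 y)%:E < a)%E].

(* A family x stands for the sum over m of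
     (x m).1 (x) e_0 + (x m).2 (x) e_1
   in the summands indexed by m. *)
Definition chain_family (R : realType) : Type :=
  int * int -> sing_chain R * sing_chain R.
HB.instance Definition _ (R : realType) := GRing.Zmodule.on (chain_family R).

(* The degree d part of the subcomplex of level a. *)
Definition domain_complex {R : realType} (Omega : set (R * R)) (a : \bar R)
    (d : int) : set (chain_family R) :=
  [set x | [/\ finite_set [set m | x m <> 0],
               forall m, ~~ index_set m -> x m = 0
             & forall m, index_set m ->
                 chains_in (sublevel Omega a m)
                   (d + 1 - 2 * (m.1 + m.2)) (x m).1 /\
                 chains_in (sublevel Omega a m)
                   (d - 2 * (m.1 + m.2)) (x m).2]].

(* The sign depends on the degree d of x, which x itself does not determine. *)
Definition bd {R : realType} (d : int) (x : chain_family R) : chain_family R :=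
  fun m => if index_set m then
    (sing_bd (x m).1,
     sing_bd (x m).2 + ((-1) ^ d : rat) *:
       (m.2%:~R *: (x (m.1 + 1, m.2)).1 - m.1%:~R *: (x (m.1, m.2 + 1)).1))
  else 0.

(* Representatives, in the complex of level b, of the cycles and of the
   boundaries of the quotient complex. *)
Definition rel_cycles {R : realType} (Omega : set (R * R)) (a b : \bar R)
    (d : int) : set (chain_family R) :=
  [set x | domain_complex Omega b d x /\
     domain_complex Omega a (d - 1) (bd d x)].

Definition rel_boundaries {R : realType} (Omega : set (R * R))
    (a b : \bar R) (d : int) : set (chain_family R) :=
  [set x | domain_complex Omega b d x /\
     exists2 y, domain_complex Omega b (d + 1) y
              & domain_complex Omega a d (x - bd (d + 1) y)].

Definition hclass {R : realType} (Omega : set (R * R)) (a b : \bar R)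
    (d : int) (x : chain_family R) : set (chain_family R) :=
  [set x' | rel_boundaries Omega a b d (x' - x)].

(* Homology classes are cosets of the boundaries in the cycles. *)
Definition homology {R : realType} (Omega : set (R * R)) (a b : \bar R)
    (d : int) : set (set (chain_family R)) :=
  [set hclass Omega a b d x | x in rel_cycles Omega a b d].

(* The map to the homology of the quotient of level b by level a induced by an
   inclusion of complexes: the class of x is sent to the class of x. *)
Definition hmap {R : realType} (Omega : set (R * R)) (a b : \bar R)
    (d : int) (h : set (chain_family R)) : set (chain_family R) :=
  \bigcup_(x in h) hclass Omega a b d x.

(* The elements of the inverse limit are families indexed by delta in ]0, a[;
   the values at other delta are irrelevant. *)
Definition pos_homology {R : realType} (Omega : set (R * R)) (a : \bar R)
    (d : int) : set (R -> set (chain_family R)) :=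
  [set h |
    (forall delta : R, 0 < delta -> (delta%:E < a)%E ->
       homology Omega delta%:E a d (h delta)) /\
    (forall delta delta' : R, 0 < delta -> delta <= delta' ->
       (delta'%:E < a)%E -> hmap Omega delta'%:E a d (h delta) = h delta')].

(* The natural map; its component at delta may be computed from any component
   of h at an index in ]0, a[ which is at most delta, and Num.min delta (a / 2)
   is one. *)
Definition natural_map {R : realType} (Omega : set (R * R)) (a : R) (d : int)
    (h : R -> set (chain_family R)) : R -> set (chain_family R) :=
  fun delta => hmap Omega delta%:E +oo%E d (h (Num.min delta (a / 2))).

Definition natural_map_nonzero {R : realType} (Omega : set (R * R)) (a : R)
    (d : int) : Prop :=
  exists2 h, pos_homology Omega a%:E d h
           & exists delta : R, 0 < delta /\
               natural_map Omega a d h delta <> hclass Omega delta%:E +oo%E d 0.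

(* The infimum is taken in the extended reals, so that it is +oo when no level
   qualifies. *)
Definition capacity {R : realType} (Omega : set (R * R)) (k : nat) : \bar R :=
  ereal_inf [set a%:E | a in
    [set a : R | 0 < a /\ natural_map_nonzero Omega a (2 * k + 1)%:Z]].

Definition is_max {R : realType} (S : set R) (M : R) : Prop :=
  S M /\ ubound S M.

(* Main.v *)
(* HEADER *)
Require Import Defs.
From mathcomp Require Import all_boot all_order all_algebra.
From mathcomp Require Import all_classical all_reals all_analysis.
From mathcomp.multinomials Require Import freeg.
From mathcomp Require Import zify ring lra.

Import Order.TTheory GRing.Theory Num.Theory.
Import numFieldNormedType.Exports.

Local Open Scope classical_set_scope.
Local Open Scope ring_scope.

(** Write U for the open complement of Omega and A_m for the linear forms. In degree 2k+1 the
    summands with m_1 + m_2 = k + 1 carry 0-chains times e_0, and those with m_1 + m_2 = k carry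
    1-chains times e_1. Everything is decided by the total weights of the 0-chains X_q in the
    summands (q, k + 1 - q), 1 <= q <= k.

    Topology of the sublevel sets. U is acyclic. Let e be positive and at most the smaller axis
    intercept of Omega ([corner]). By convexity Omega contains the triangle y_1 + y_2 <= e, so U(e :
    m) is empty when both coordinates of m are positive ([sublevel_empty]). When one coordinate is
    nonpositive, convexity makes U(e : m) acyclic ([acyclic_sublevel_lower],
    [acyclic_sublevel_upper]). Filling first the e_0 and then the e_1 components shows that a
    relative cycle of odd degree is a boundary at level infinity once its 0-chains in the summands
    with positive m have weight 0 ([cycle_is_boundary]).

    Lower bound ([natural_map_zero]). Suppose that for each j some p_j in Omega has A_{j,k-j}(p_j)
    >= a. The ray of p_j misses the part of U where A_{j,k-j} < a, so the points of a 0-chain there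
    can be counted separately to its left and to its right, and boundaries count 0. The cycle
    equation at (j, k - j) equates k - j times the count of X_{j+1} with j times the count of X_j,
    up to a chain in U(e : j, k - j), which avoids the counted side. By convexity the rays of p_j
    and p_{j+1} induce the same left and right on the support of X_{j+1}. Left counts vanish by
    induction upwards from j = 0, right counts by induction downwards from j = k. So every X_q has
    weight 0, and the natural map is zero.

    Upper bound ([natural_map_nonzero_gt]). If a exceeds the maximum of A_{j0,k-j0} on Omega, a
    slightly dilated boundary curve of Omega lies in the sublevel set of that form. Points of this
    curve with factorial coefficients, joined by arcs of it, form a compatible family of relative
    cycles. The component at (1, k) has nonzero weight, and U(e : 1, k) is empty, so the class
    survives at level infinity. *)

Section Chains.
Context {R : realType}.
Implicit Types (c : sing_chain R) (s : sing_simplex R) (U V : set (R * R)).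

(** * Linear extension of maps defined on singular simplices *)

Section Lift.
Context {M : lmodType rat} (f : sing_simplex R -> M).

Lemma fgliftE c : fglift f c = \sum_(s <- dom c) coeff s c *: f s.
Proof. by rewrite -{1}(Freeg_dom c) fglift_Freeg /prelift big_map. Qed.

Lemma fgliftB : {morph fglift f : c d / c - d}.
Proof. exact: lift_is_additive. Qed.

Lemma fglift0 : fglift f 0 = 0.
Proof. by rewrite -(subrr (0 : sing_chain R)) fgliftB subrr. Qed.

Lemma fgliftN : {morph fglift f : c / - c}.
Proof. by move=> c; rewrite -sub0r fgliftB fglift0 sub0r. Qed.

Lemma fgliftD : {morph fglift f : c d / c + d}.
Proof. by move=> c d; rewrite -[d in LHS]opprK fgliftB fgliftN opprK. Qed.

Lemma fgliftU s : fglift f << s >> = f s.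
Proof. by rewrite liftU scale1r. Qed.

Lemma fglift_sum I (r : seq I) (P : pred I) (F : I -> sing_chain R) :
  fglift f (\sum_(i <- r | P i) F i) = \sum_(i <- r | P i) fglift f (F i).
Proof. exact: (big_morph _ fgliftD fglift0). Qed.

Lemma scaleU (q : rat) s : q *: (<< s >> : sing_chain R) = << q *g s >>.
Proof.
apply/eqP/freeg_eqP => t; rewrite coeffZ !coeffU; ring.
Qed.

Lemma fgliftZ (q : rat) c : fglift f (q *: c) = q *: fglift f c.
Proof.
rewrite -{1}(freeg_sumE c) scaler_sumr fglift_sum fgliftE scaler_sumr.
apply: eq_bigr => s _; rewrite -scaleU scalerA scaleU liftU.
by rewrite scalerA.
Qed.

End Lift.

Lemma chain_sumE c : \sum_(s <- dom c) coeff s c *: << s >> = c.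
Proof. by rewrite -[RHS]freeg_sumE; apply: eq_bigr => s _; rewrite scaleU. Qed.

(** * The singular boundary and chains supported in a set *)

Lemma sing_bd0 : sing_bd (0 : sing_chain R) = 0. Proof. exact: fglift0. Qed.
Lemma sing_bdD : {morph @sing_bd R : c d / c + d}. Proof. exact: fgliftD. Qed.
Lemma sing_bdN : {morph @sing_bd R : c / - c}. Proof. exact: fgliftN. Qed.
Lemma sing_bdB : {morph @sing_bd R : c d / c - d}. Proof. exact: fgliftB. Qed.
Lemma sing_bdZ (q : rat) c : sing_bd (q *: c) = q *: sing_bd c.
Proof. exact: fgliftZ. Qed.
Lemma sing_bd_sum I (r : seq I) (P : pred I) (F : I -> sing_chain R) :
  sing_bd (\sum_(i <- r | P i) F i) = \sum_(i <- r | P i) sing_bd (F i).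
Proof. exact: fglift_sum. Qed.

Lemma chains_in0 U n : chains_in U n (0 : sing_chain R).
Proof. by move=> s; rewrite dom0. Qed.

Lemma chains_inD U n c d :
  chains_in U n c -> chains_in U n d -> chains_in U n (c + d).
Proof.
move=> cU dU s /domD_subset; rewrite mem_cat => /orP[]; [exact: cU|exact: dU].
Qed.

Lemma chains_inN U n c : chains_in U n c -> chains_in U n (- c).
Proof. by move=> cU s; rewrite domN; exact: cU. Qed.

Lemma chains_inB U n c d :
  chains_in U n c -> chains_in U n d -> chains_in U n (c - d).
Proof. by move=> cU dU; apply: chains_inD => //; exact: chains_inN. Qed.

Lemma chains_inZ U n (q : rat) c : chains_in U n c -> chains_in U n (q *: c).
Proof. by move=> cU s /domZ_subset; exact: cU. Qed.

Lemma chains_in_sum U n (I : eqType) (r : seq I) (P : pred I)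
    (F : I -> sing_chain R) :
  (forall i, i \in r -> P i -> chains_in U n (F i)) ->
  chains_in U n (\sum_(i <- r | P i) F i).
Proof.
move=> FU; rewrite big_seq_cond; apply: big_ind => [||i /andP[]].
- exact: chains_in0.
- by move=> *; exact: chains_inD.
- exact: FU.
Qed.

Lemma chains_inU U n s :
  (projT1 s)%:Z = n -> range (projT2 s) `<=` U -> chains_in U n << s >>.
Proof. by move=> sn sU t; rewrite domU1 inE => /eqP ->. Qed.

Lemma chains_inS U V n c : U `<=` V -> chains_in U n c -> chains_in V n c.
Proof. by move=> UV cU s /cU[? ?]; split => //; exact: subset_trans UV. Qed.

Lemma chains_in_set0 n c : chains_in set0 n c -> c = 0.
Proof.
move=> c0; apply/eqP; rewrite -dom_eq0; case E : (dom c) => [//|s r].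
have [_] : (projT1 s)%:Z = n /\ range (projT2 s) `<=` set0.
  by apply: c0; rewrite E mem_head.
have t : std_simplex R (projT1 s).
  exists (\row_j (j == ord0)%:R); apply/mem_set; split.
    by move=> j; rewrite mxE ler0n.
  rewrite (bigD1 ord0)//= mxE eqxx big1 ?addr0// => j /negbTE j0.
  by rewrite mxE j0.
by move=> /(_ (projT2 s t)) []; exists t.
Qed.

Lemma chains_in_lt0 U n c : n < 0 -> chains_in U n c -> c = 0.
Proof.
move=> n0 cU; apply/eqP; rewrite -dom_eq0; case E : (dom c) => [//|s r].
have [sn _] : (projT1 s)%:Z = n /\ range (projT2 s) `<=` U.
  by apply: cU; rewrite E mem_head.
by lia.
Qed.

Lemma sing_simplex_bd_in U n s :
  (projT1 s)%:Z = n -> range (projT2 s) `<=` U ->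
  chains_in U (n - 1) (sing_simplex_bd s).
Proof.
case: s => -[|m] s /= mn sU; first exact: chains_in0.
apply: chains_in_sum => i _ _; apply: chains_inZ; apply: chains_inU => /=.
  by rewrite -mn; lia.
by move=> _ [t _ <-]; apply: sU; exists (face i t).
Qed.

Lemma sing_bd_in U n c : chains_in U n c -> chains_in U (n - 1) (sing_bd c).
Proof.
move=> cU; rewrite /sing_bd fgliftE; apply: chains_in_sum => s sc _.
by apply: chains_inZ; have [] := cU _ sc; exact: sing_simplex_bd_in.
Qed.

(** The simplicial identity for iterated faces. The indices live in different ordinal types, hence
    the equations between their values in [nat]. *)
Lemma insert0_comm n (i : 'I_n.+3) (j : 'I_n.+2) (i' : 'I_n.+2) (j' : 'I_n.+3)
    (t : 'rV[R]_n.+1) :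
  (j < i)%N -> j' = j :> nat -> i' = i.-1 :> nat ->
  insert0 i (insert0 j t) = insert0 j' (insert0 i' t).
Proof.
move=> ji j'j i'i; apply/rowP => l; rewrite !mxE.
have unl m (h l0 : 'I_m.+1) : unlift h l0 =
    if l0 == h then None else unlift h l0 by case: unliftP => [a ->|->];
    rewrite ?eqxx// eq_sym (negbTE (neq_lift _ _)).
case: unliftP => [l1 ->|->]; case: unliftP => [l2 E2|E2].
- rewrite !mxE; case: unliftP => [l3 E3|E3]; case: unliftP => [l4 E4|E4] => //.
  + congr (t ord0 _); apply: val_inj; have /(congr1 val)/= := E2.
    rewrite E3 E4 /= /bump.
    by have := ltn_ord l3; have := ltn_ord l4; lia.
  + have /(congr1 val)/= := E2; rewrite E3 E4 /= /bump; lia.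
  + have /(congr1 val)/= := E2; rewrite E3 E4 /= /bump; lia.
- rewrite mxE; case: unliftP => [l3 E3|//].
  have /(congr1 val)/= := E2; rewrite E3 /= /bump; lia.
- rewrite mxE; case: unliftP => [l3 E3|//].
  have /(congr1 val)/= := E2; rewrite E3 /= /bump; lia.
- by [].
Qed.

Lemma eq_set_val (T : Type) (A : set T) (x y : A) : set_val x = set_val y -> x = y.
Proof. by case: x y => [x xA] [y yA]; rewrite !set_valE /= => e; exact: eq_exist. Qed.

Lemma sing_simplexP n (f g : continuousType (std_simplex R n) (R * R)%type) :
  f =1 g -> existT _ n f = existT _ n g :> sing_simplex R.
Proof. by move=> /continuousEP ->. Qed.

(** Induction by borders: passing from N to N + 1 adds the row i = N + 1 and the column j = N, whose
    entries agree in pairs by the hypothesis and have opposite parities of i + j. *)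
Lemma alternating_sum0 {V : zmodType} (F : nat -> nat -> V) N :
  (forall i j, (j < i)%N -> (i <= N)%N -> F i j = F j i.-1) ->
  \sum_(0 <= i < N.+1) \sum_(0 <= j < N)
    (if odd (i + j) then - F i j else F i j) = 0.
Proof.
elim: N => [|N IH] FE; first by rewrite big_nat1 big_geq.
rewrite big_nat_recr//= (eq_bigr _ (fun i _ => big_nat_recr _ _ _ _))//=.
rewrite big_split/= IH ?add0r; last by move=> i j ji iN; apply: FE => //; lia.
rewrite -big_split/= big_nat_cond big1// => i /andP[/andP[_ iN] _].
by rewrite (FE N.+1 i)//= addnC; case: odd; rewrite /= ?addNr ?subrr.
Qed.

Lemma sing_bdK c : sing_bd (sing_bd c) = 0.
Proof.
rewrite {2}/sing_bd fgliftE sing_bd_sum big1// => -[[|[|n]] s] _;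
  rewrite sing_bdZ /=.
- by rewrite sing_bd0 scaler0.
- rewrite sing_bd_sum big1 ?scaler0// => i _.
  by rewrite sing_bdZ /sing_bd fgliftU /= scaler0.
rewrite sing_bd_sum.
(* Faces are indexed by naturals through [inord], so that the double sum takes the form of
   [alternating_sum0]. *)
pose F i j : sing_chain R := << sing_face (s \o @face R n.+1 (inord i)
    : continuousType _ _) (@inord n.+1 j) >>.
rewrite (_ : \sum_(i < _) _ = 0) ?scaler0//.
rewrite -[RHS](@alternating_sum0 _ F n.+2); last first.
  move=> i j ji iN; rewrite /F; congr (<< _ >>).
  apply: sing_simplexP => t /=; congr (s _); apply: eq_set_val => /=.
  by rewrite !set_valE /=; apply: insert0_comm; rewrite !inordK//; lia.
rewrite big_mkord; apply: eq_bigr => i _.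
rewrite sing_bdZ /sing_bd fgliftU /= big_mkord scaler_sumr.
apply: eq_bigr => j _; rewrite scalerA -exprD -signr_odd /F !inord_val.
by case: odd; rewrite /= ?expr1 ?expr0 ?scaleN1r ?scale1r.
Qed.

End Chains.

(** * Cones over functions on the standard simplex *)

Section Cone.
Context {R : realType}.

Lemma simplex_neq0 n : std_simplex R n !=set0.
Proof.
exists (\row_j (j == ord0)%:R); split; first by move=> j; rewrite mxE ler0n.
rewrite (bigD1 ord0)//= mxE eqxx big1 ?addr0// => j /negbTE j0.
by rewrite mxE j0.
Qed.

(** A chosen point: it is the only point of the 0-simplex, and the default value in [tailv]. *)
Definition vertex n : std_simplex R n :=
  exist _ (projT1 (cid (simplex_neq0 n))) (mem_set (projT2 (cid (simplex_neq0 n)))).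

Definition bary {n} (t : std_simplex R n) (j : 'I_n.+1) : R :=
  (set_val t : 'rV_n.+1) ord0 j.

Lemma simplex_le1 {n} (t : std_simplex R n) j : 0 <= bary t j <= 1.
Proof.
have /set_mem[t0 t1] := valP t; rewrite /bary t0/= -t1 (bigD1 j)//=.
by rewrite lerDl sumr_ge0.
Qed.

Lemma simplex0_eq (t u : std_simplex R 0) : t = u.
Proof.
apply: eq_set_val; apply/rowP => j.
have /set_mem[_] := valP t; have /set_mem[_] := valP u.
by rewrite !big_ord1 (ord1 j) => -> ->.
Qed.

Lemma compact_simplex n : compact (std_simplex R n).
Proof.
apply: bounded_closed_compact.
  exists 1; split => // M M1 t [t0 t1] /=; rewrite [leLHS]/Num.norm/= mx_normrE.
  apply/bigmax_leP; split => [|[i j] _]; first by rewrite (le_trans _ (ltW M1)).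
  rewrite (ord1 i)/= ger0_norm//; apply: le_trans (ltW M1).
  by rewrite -t1 (bigD1 j)//= lerDl sumr_ge0.
rewrite (_ : std_simplex R n = (\bigcap_j [set t | 0 <= t ord0 j]) `&`
    [set t | \sum_j t ord0 j = 1]); last first.
  apply/seteqP; split => t [t0 t1]; split => //; first by move=> j _; exact: t0.
  by move=> j; exact: t0.
apply: closedI.
  apply: closed_bigI => j _.
  apply: (@preimage_closed _ _ (fun t : 'rV[R]_n.+1 => t ord0 j) [set x | 0 <= x]); last first.
    exact: closed_ge.
  by move=> t _; exact: coord_continuous.
apply: (@preimage_closed _ _ (fun t : 'rV[R]_n.+1 => \sum_j t ord0 j) [set x | x = 1]); last first.
  exact: closed_eq.
move=> t _; have FF : Filter (nbhs t) by exact: nbhs_filter.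
apply: (@cvg_big _ _ _ _ _ _ _ _ _ _ _ FF) => [|j _]; first exact: add_continuous.
exact: coord_continuous.
Qed.

Lemma simplex_min {n} {f : std_simplex R n -> R} : continuous f ->
  exists u, forall t, f u <= f t.
Proof.
move=> /subspace_valL_continuousP cf.
have [u uA fu] :=
  compact_EVT_min (simplex_neq0 n) (@compact_simplex n) cf.
pose w : std_simplex R n := exist (fun t => t \in std_simplex R n) u uA.
exists w => t.
have vE (v : std_simplex R n) : valL f (set_val v) = f v.
  by rewrite -[RHS](congr1 (@^~ v) (valLK point f)).
have := fu (set_val t) (valP t).
by rewrite vE -[f w]vE.
Qed.

(** Projection from the vertex 0 onto the opposite face. At that vertex the projection is undefined
    and the value is arbitrary. *)
Definition tailv {n} (t : 'rV[R]_n.+2) : 'rV[R]_n.+1 :=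
  if t ord0 ord0 == 1 then set_val (vertex n)
  else (1 - t ord0 ord0)^-1 *: \row_j t ord0 (fintype.lift ord0 j).

Lemma tailv_simplex {n} (t : std_simplex R n.+1) :
  tailv (set_val t) \in std_simplex R n.
Proof.
rewrite /tailv; case: eqP => [_|/eqP t1]; first exact: (valP (vertex n)).
have := valP t => /set_mem[tge0]; rewrite big_ord_recl => tE.
apply/mem_set; split=> [j|]; rewrite ?mxE.
  rewrite mulr_ge0// invr_ge0 subr_ge0.
  by have /andP[] := @simplex_le1 n.+1 t ord0.
under eq_bigr => j do rewrite !mxE.
rewrite -mulr_sumr -tE addrAC subrr add0r mulVf//.
move: t1; apply: contra => /eqP t1; move: tE; rewrite t1 addr0.
by move/eqP.
Qed.

Definition tail {n} (t : std_simplex R n.+1) : std_simplex R n :=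
  exist _ (tailv (set_val t)) (tailv_simplex t).

Lemma continuous_bary n j : continuous (fun t : std_simplex R n => bary t j).
Proof.
move=> t; apply: (@continuous_comp _ _ _ set_val (fun v : 'rV_n.+1 => v ord0 j)).
  exact: initial_continuous.
exact: coord_continuous.
Qed.

Lemma continuous_tail {n} {t : std_simplex R n.+1} :
  bary t ord0 != 1 -> {for t, continuous (@tail n)}.
Proof.
move=> t1.
suff C : {for t, continuous (fun u : std_simplex R n.+1 => tailv (set_val u))}.
  move=> U /= [_ [[W oW <-]] /= Wt] WU.
  have FF : Filter (nbhs t) by exact: nbhs_filter.
  have := C W (open_nbhs_nbhs (conj oW Wt)).
  by apply: (@filterS _ (nbhs t) FF) => u Wu; exact: WU.
have FF : Filter (nbhs t) by exact: nbhs_filter.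
have tn1 : \forall u \near t, bary u ord0 != 1.
  exact: (@continuous_bary n.+1 ord0 t _ (open_nbhs_nbhs (conj (@open_neq _ 1) t1))).
rewrite /prop_for /continuous_at.
apply: (@cvg_trans _ ((fun u => (1 - bary u ord0)^-1 *:
   \row_j bary u (fintype.lift ord0 j)) @ t)).
  apply: near_eq_cvg; near=> u; rewrite /tailv ifN//; near: u; exact: tn1.
rewrite /tailv -/(bary _ _) (negbTE t1); apply: (@cvgZ _ _ _ _ FF).
  apply: cvgV; first by rewrite subr_eq0 eq_sym.
  apply: cvgB; [exact: cvg_cst|exact: continuous_bary].
apply/(@cvg_ballP _ _ _ _ FF) => e e0.
have : \forall u \near t, forall j : 'I_n.+1,
    ball (bary t (fintype.lift ord0 j)) e (bary u (fintype.lift ord0 j)).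
  apply: (@filter_forall _ _ (fun j => [set u | ball (bary t (fintype.lift ord0 j)) e
    (bary u (fintype.lift ord0 j))]) _ FF) => j.
  have /(@cvg_ballP _ _ _ _ FF)/(_ e e0) := @continuous_bary n.+1 (fintype.lift ord0 j) t.
  exact.
move=> H; near=> u; split=> // k j; rewrite (ord1 k) !mxE.
by move: j; near: u.
Unshelve. all: by end_near. Qed.

Definition coneR {n} (f : std_simplex R n -> R) (p : R)
    (t : std_simplex R n.+1) : R :=
  bary t ord0 * p + (1 - bary t ord0) * f (tail t).

(** Away from the apex [tail] is continuous. At the apex it need not be, but f is bounded on the
    compact simplex and its coefficient tends to 0. *)
Lemma continuous_coneR {n} {f : std_simplex R n -> R} {p} :
  continuous f -> continuous (coneR f p).
Proof.
move=> cf t.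
have cc := @continuous_bary n.+1 ord0 t.
have FF : Filter (nbhs t) by exact: nbhs_filter.
apply: (@cvgD _ _ _ _ FF); first by apply: (@cvgM _ _ _ FF) => //; exact: cvg_cst.
have [t1|t1] := eqVneq (bary t ord0) 1; last first.
  apply: (@cvgM _ _ _ FF); first by apply: (@cvgB _ _ _ _ FF) => //; exact: cvg_cst.
  by apply: continuous_comp; [exact: continuous_tail|exact: cf].
have [u fu] := simplex_min cf.
have [v fv] : exists v, forall t, - f v <= - f t.
  apply: (@simplex_min _ (fun t => - f t)) => x.
  have FX : Filter (nbhs x) by exact: nbhs_filter.
  by apply: (@cvgN _ _ _ _ FX); exact: cf.
rewrite t1 subrr mul0r.
have c0 : 1 - bary x ord0 @[x --> t] --> (0 : R).
  by rewrite -(subrr 1) -{3}t1; apply: (@cvgB _ _ _ _ FF) => //; exact: cvg_cst.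
apply: (@squeeze_cvgr _ _ FF _ (fun x => (1 - bary x ord0) * f u)
  (fun x => (1 - bary x ord0) * f v)).
- near=> x; have /andP[_ x1] := @simplex_le1 n.+1 x ord0.
  rewrite !ler_wpM2l ?subr_ge0//.
  by have := fv (tail x); rewrite lerN2.
- by rewrite -(mul0r (f u)); apply: (@cvgM _ _ _ FF) => //; exact: cvg_cst.
- by rewrite -(mul0r (f v)); apply: (@cvgM _ _ _ FF) => //; exact: cvg_cst.
Unshelve. all: by end_near. Qed.

Lemma set_val_face {n} (i : 'I_n.+2) (t : std_simplex R n) :
  set_val (face i t) = insert0 i (set_val t).
Proof. by []. Qed.

Lemma set_val_tail {n} (t : std_simplex R n.+1) :
  set_val (tail t) = tailv (set_val t).
Proof. by []. Qed.

Lemma tail_face0 {n} (t : std_simplex R n) : tail (face ord0 t) = t.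
Proof.
apply: eq_set_val; rewrite set_val_tail /tailv /bary set_val_face.
rewrite mxE unlift_none eq_sym oner_eq0 subr0 invr1 scale1r; apply/rowP => j.
by rewrite !mxE liftK.
Qed.

Lemma coneR_face0 {n} (f : std_simplex R n -> R) p t :
  coneR f p (face ord0 t) = f t.
Proof.
rewrite /coneR tail_face0 /bary set_val_face mxE unlift_none.
by rewrite mul0r subr0 mul1r add0r.
Qed.

Lemma coneR_face {n} (f : std_simplex R n.+1 -> R) p (i : 'I_n.+2) t :
  coneR f p (face (fintype.lift ord0 i) t) = coneR (f \o face i) p t.
Proof.
have E0 : bary (face (fintype.lift ord0 i) t) ord0 = bary t ord0.
  rewrite /bary set_val_face mxE.
  case: unliftP => [j /(congr1 val)|/(congr1 val)//].
  rewrite /= /bump leq0n add1n => /esym.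
  by case: ltnP => // _ /=; rewrite ?add0n => j0; congr (_ _ _); apply: val_inj; rewrite /= j0.
rewrite /coneR E0.
have [->|t1] := eqVneq (bary t ord0) 1; first by rewrite subrr !mul0r.
rewrite /comp; congr (_ + _ * f _); apply: eq_set_val.
change (tailv (set_val (face (fintype.lift ord0 i) t)) = insert0 i (tailv (set_val t))).
rewrite /tailv -!/(bary _ _) E0 (negbTE t1); apply/rowP => j.
rewrite !mxE.
case: (unliftP i j) => [j' ->|->].
  rewrite !mxE; congr (_ * _).
  rewrite (_ : fintype.lift ord0 (fintype.lift i j') =
    fintype.lift (fintype.lift ord0 i) (fintype.lift ord0 j')) ?liftK//.
  by apply: val_inj; rewrite /= /bump; lia.
by rewrite unlift_none mulr0.
Qed.

Lemma coneR_vertex (f : std_simplex R 0 -> R) p (i : 'I_1) t :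
  coneR f p (face (fintype.lift ord0 i) t) = p.
Proof.
have E0 : bary (face (fintype.lift ord0 i) t) ord0 = 1.
  have /set_mem[_] := valP (face (fintype.lift ord0 i) t).
  rewrite big_ord_recl big_ord1 => <-.
  rewrite [in RHS](_ : fintype.lift ord0 ord0 = fintype.lift ord0 i).
    by rewrite [X in _ = _ + X](_ : _ = 0) ?addr0//= mxE unlift_none.
  by rewrite (ord1 i).
by rewrite /coneR E0 mul1r subrr mul0r addr0.
Qed.

Lemma coneR_itv {n} (t : std_simplex R n.+1) :
  exists l u, [/\ 0 <= l, l <= 1 & forall (f : std_simplex R n -> R) p,
    coneR f p t = (1 - l) * f u + l * p].
Proof.
exists (bary t ord0), (tail t); have /andP[? ?] := @simplex_le1 n.+1 t ord0.
by split => // g q; rewrite /coneR addrC.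
Qed.
End Cone.

(** * Acyclic sets, by cones taken in a chart *)

Section Acyclic.
Context {R : realType}.
Implicit Types (c : sing_chain R) (s : sing_simplex R) (U V : set (R * R)).

Definition pt_simplex (q : R * R) : sing_simplex R :=
  existT _ 0%N (cst q : continuousType (std_simplex R 0) (R * R)%type).

(** For [cst 1] this is the augmentation; for an indicator function it counts, with multiplicity,
    the points of a 0-chain in a region. *)
Definition weight (w : R * R -> rat) : sing_chain R -> rat^o :=
  fglift (fun s : sing_simplex R =>
    match s with existT 0%N f => w (f (vertex 0)) | _ => 0 end : rat^o).

Lemma weightU w q : weight w << pt_simplex q >> = w q.
Proof. exact: fgliftU. Qed.

Lemma eq_weight V n w w' c : chains_in V n c -> {in V, w =1 w'} ->
  weight w c = weight w' c.
Proof.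
move=> cV ww'; rewrite /weight !fgliftE big_seq [RHS]big_seq.
apply: eq_bigr => -[[|m] f] sc //; congr (_ *: _); apply: ww'.
by apply/mem_set; have [_] := cV _ sc; apply; exists (vertex 0).
Qed.

Lemma weight_bd w c :
  (forall f : continuousType (std_simplex R 1) (R * R)%type,
     existT _ 1%N f \in dom c -> forall t u, w (f t) = w (f u)) ->
  weight w (sing_bd c) = 0.
Proof.
move=> wc; rewrite /sing_bd fgliftE /weight fglift_sum big_seq big1// => s sc.
rewrite fgliftZ; case: s sc => -[|[|m]] f sc /=.
- by rewrite fglift0 scaler0.
- rewrite big_ord_recl big_ord1 fgliftD !fgliftZ !fgliftU /=.
  rewrite (wc f sc (face (fintype.lift ord0 ord0) (vertex 0)) (face ord0 (vertex 0))).
  by rewrite expr0 expr1 scale1r scaleN1r subrr scaler0.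
- rewrite fglift_sum big1 ?scaler0// => i _.
  by rewrite fgliftZ fgliftU /= scaler0.
Qed.

(** Vanishing of reduced singular homology, the augmentation entering in degree 0 only. *)
Definition acyclic V := V !=set0 /\
  forall n c, chains_in V n c -> sing_bd c = 0 ->
    (n = 0 -> weight (cst 1) c = 0) ->
    exists2 b, chains_in V (n + 1) b & sing_bd b = c.

Lemma pt_simplex_in V q : V q -> chains_in V 0 << pt_simplex q >>.
Proof. by move=> Vq; apply: chains_inU => // _ [t _ <-]. Qed.

(** The exact sequence of the pair (U, V) made explicit: the boundary of c is filled in V by b', and
    the cycle c - b' is then filled in U. In degree 0, a point of V with the weight of c replaces
    b'. *)
Lemma acyclic_rel U V n c : V `<=` U -> acyclic U -> acyclic V ->
  chains_in U n c -> chains_in V (n - 1) (sing_bd c) ->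
  exists2 b, chains_in U (n + 1) b & chains_in V n (c - sing_bd b).
Proof.
move=> VU [_ aU] [[q Vq] aV] cU cV.
have [n0|n0] := eqVneq n 0.
  rewrite n0 in cU cV *.
  pose e : sing_chain R := weight (cst 1) c *: << pt_simplex q >>.
  have eV : chains_in V 0 e by apply: chains_inZ; exact: pt_simplex_in.
  have [||_|b bU bc] := aU 0 (c - e).
  - by apply: chains_inB => //; exact: chains_inS eV.
  - apply: (@chains_in_lt0 _ U (-1)) => //; apply: (sing_bd_in U 0).
    by apply: chains_inB => //; exact: chains_inS eV.
  - rewrite /weight fgliftB fgliftZ fgliftU /=.
    by rewrite [X in _ - X]mulr1 subrr.
  - by exists b => //; rewrite bc opprB addrC subrK.
have [|||b' b'V b'c] := aV (n - 1) (sing_bd c) => //.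
- exact: sing_bdK.
- by move=> _; apply: weight_bd.
rewrite subrK in b'V.
have [|||b bU bc] := aU n (c - b').
- by apply: chains_inB => //; exact: chains_inS b'V.
- by rewrite sing_bdB b'c subrr.
- by move=> n0'; rewrite n0' eqxx in n0.
by exists b => //; rewrite bc opprB addrC subrK.
Qed.

Section ConeChain.
Variables (Psi Phi : R * R -> R * R) (V : set (R * R)).
Hypothesis cPsi : continuous Psi.
Hypothesis cPhi : forall y, V y ->
  {for y, continuous (fun x => (Phi x).1)} /\
  {for y, continuous (fun x => (Phi x).2)}.
Hypothesis PsiPhi : forall y, V y -> Psi (Phi y) = y.

Definition cone_fun (p : R * R) n (f : std_simplex R n -> R * R)
    (t : std_simplex R n.+1) : R * R :=
  Psi (coneR (fun u => (Phi (f u)).1) p.1 t,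
       coneR (fun u => (Phi (f u)).2) p.2 t).

(** The value 0 is a default for discontinuous cones; it does not occur for simplices in V, by
    [coneSP]. *)
Definition coneS (p : R * R) (s : sing_simplex R) : sing_chain R :=
  match pselect (continuous (cone_fun p _ (projT2 s))) with
  | left cf => << existT _ (projT1 s).+1 (mkcts cf : continuousType _ _) >>
  | right _ => 0
  end.

Lemma coneSP p n (f : continuousType (std_simplex R n) (R * R)%type) :
  range f `<=` V ->
  exists2 F : continuousType (std_simplex R n.+1) (R * R)%type,
    F =1 cone_fun p n f & coneS p (existT _ n f) = << existT _ n.+1 F >>.
Proof.
move=> fV; rewrite /coneS; case: pselect => /= [cf|[]].
  by exists (mkcts cf : continuousType _ _).
have cPf1 : continuous (fun u => (Phi (f u)).1).
  move=> u; apply: (@continuous_comp _ _ _ f (fun x => (Phi x).1)).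
    exact: cts_fun.
  by apply: (cPhi _ _).1; apply: fV; exists u.
have cPf2 : continuous (fun u => (Phi (f u)).2).
  move=> u; apply: (@continuous_comp _ _ _ f (fun x => (Phi x).2)).
    exact: cts_fun.
  by apply: (cPhi _ _).2; apply: fV; exists u.
move=> t; apply: (@continuous_comp _ _ _ (fun t => (coneR (fun u => (Phi (f u)).1) p.1 t,
   coneR (fun u => (Phi (f u)).2) p.2 t)) Psi); last exact: cPsi.
have FF : Filter (nbhs t) by exact: nbhs_filter.
by apply: (@cvg_pair _ _ _ (nbhs t) (nbhs _) (nbhs _) FF); exact: continuous_coneR.
Qed.

Lemma sing_bd_coneS p s : range (projT2 s) `<=` V ->
  sing_bd (coneS p s) = << s >> -
    (if projT1 s == 0%N then << pt_simplex (Psi p) >>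
     else fglift (coneS p) (sing_simplex_bd s)).
Proof.
case: s => n f /= fV; have [F FE ->] := coneSP p n f fV.
rewrite /sing_bd fgliftU /= big_ord_recl expr0 scale1r; congr (_ + _).
  congr (<< _ >>); apply: sing_simplexP => t; rewrite /= FE /cone_fun.
  rewrite !coneR_face0 -[RHS]PsiPhi; last by apply: fV; exists t.
  by case: (Phi _).
case: n f fV F FE => [|n] f fV F FE /=.
  rewrite big_ord1 expr1 scaleN1r; congr (- << _ >>).
  apply: sing_simplexP => t; rewrite /= FE /cone_fun !coneR_vertex.
  by case: p {F FE}.
rewrite fglift_sum -sumrN; apply: eq_bigr => i _.
rewrite fgliftZ fgliftU /bump leq0n add1n exprS mulN1r scaleNr; congr (- (_ *: _)).
have fiV : range (f \o face i) `<=` V.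
  by move=> _ [t _ <-]; apply: fV; exists (face i t).
have [G GE ->] := coneSP p n (f \o @face R n i : continuousType _ _) fiV.
congr (<< _ >>); apply: sing_simplexP => t.
by rewrite GE /= FE /cone_fun !coneR_face.
Qed.

(** The cone is a contracting homotopy, up to the apex weighted by the augmentation in degree 0; so
    a cycle, of weight 0 if in degree 0, bounds its cone. *)
Lemma sing_bd_cone p n c : chains_in V n c ->
  sing_bd (fglift (coneS p) c) =
  c - (if n == 0 then weight (cst 1) c *: << pt_simplex (Psi p) >>
       else fglift (coneS p) (sing_bd c)).
Proof.
move=> cV; rewrite {1}fgliftE sing_bd_sum -{3}(chain_sumE c).
rewrite (_ : (if _ then _ else _) = \sum_(s <- dom c) coeff s c *:
   (if projT1 s == 0%N then << pt_simplex (Psi p) >>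
     else fglift (coneS p) (sing_simplex_bd s))).
  rewrite -sumrB big_seq [RHS]big_seq; apply: eq_bigr => s sc.
  rewrite sing_bdZ sing_bd_coneS ?scalerBr//.
  by have [] := cV _ sc.
case: ifPn => [/eqP n0|n0].
  rewrite /weight fgliftE scaler_suml big_seq [RHS]big_seq; apply: eq_bigr => s sc.
  have [sn _] := cV _ sc; case: s sc sn => [[|m] f] sc //=; last by lia.
  by rewrite [_ *: 1]mulr1.
rewrite /sing_bd (fgliftE sing_simplex_bd) fglift_sum big_seq [RHS]big_seq; apply: eq_bigr => s sc.
have [sn _] := cV _ sc; rewrite fgliftZ; case: eqP => [s0|//].
by rewrite s0 in sn; rewrite -sn in n0.
Qed.

Lemma chart_min (f : R * R -> R) (r : seq (sing_simplex R)) :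
  V !=set0 -> (forall y, V y -> {for y, continuous f}) ->
  (forall s, s \in r -> range (projT2 s) `<=` V) ->
  exists2 y, V y & forall s, s \in r -> forall t, f y <= f (projT2 s t).
Proof.
move=> V0 cf; elim: r => [|s r IH] rV; first by case: V0 => y Vy; exists y.
have [|y Vy yr] := IH; first by move=> u ur; apply: rV; rewrite inE ur orbT.
have sV : range (projT2 s) `<=` V by apply: rV; rewrite mem_head.
have [u fu] : exists u, forall t, f (projT2 s u) <= f (projT2 s t).
  apply: (@simplex_min _ _ (f \o projT2 s)) => t.
  apply: continuous_comp; first exact: cts_fun.
  by apply: cf; apply: sV; exists t.
have [le|le] := leP (f y) (f (projT2 s u)).
  exists y => // v; rewrite inE => /predU1P[-> t|]; last exact: yr.
  exact: le_trans (fu t).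
exists (projT2 s u); first by apply: sV; exists u.
move=> v; rewrite inE => /predU1P[->//|vr] t.
by apply: le_trans (ltW le) _; exact: yr.
Qed.

(* The cone is taken in the chart Phi over the corner of the smallest box
   x >= p containing the support of the chain. *)
Lemma acyclic_chart : V !=set0 ->
  (forall y y1 y2 a b, V y -> V y1 -> V y2 ->
     (Phi y1).1 <= a <= (Phi y).1 -> (Phi y2).2 <= b <= (Phi y).2 ->
     V (Psi (a, b))) ->
  acyclic V.
Proof.
move=> V0 Vbox; split=> // n c cV c0 aug0.
have cV' s : s \in dom c -> range (projT2 s) `<=` V by move=> /cV[].
have [y1 Vy1 y1c] :=
  chart_min (fun x => (Phi x).1) (dom c) V0 (fun y Vy => (cPhi y Vy).1) cV'.
have [y2 Vy2 y2c] :=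
  chart_min (fun x => (Phi x).2) (dom c) V0 (fun y Vy => (cPhi y Vy).2) cV'.
pose p := ((Phi y1).1, (Phi y2).2).
exists (fglift (coneS p) c); last first.
  rewrite (sing_bd_cone p n c cV) c0 fglift0; case: eqP => [/aug0 ->|_].
    by rewrite scale0r subr0.
  by rewrite subr0.
rewrite fgliftE; apply: chains_in_sum => s sc _; apply: chains_inZ.
have [sn sV] := cV _ sc; case: s sc sn sV => m f /= sc sn sV.
have [F FE ->] := coneSP p m f sV.
apply: chains_inU => /=; first by rewrite -sn; lia.
move=> _ [t _ <-]; rewrite FE /cone_fun.
have [l [u [l0 l1 lE]]] := coneR_itv t; rewrite !lE.
have box (a b : R) : a <= b -> a <= (1 - l) * b + l * a <= b.
  by move=> ab; apply/andP; split; nra.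
apply: (Vbox (f u) y1 y2) => //; first by apply: sV; exists u.
- by apply: box; exact: y1c _ sc u.
- by apply: box; exact: y2c _ sc u.
Qed.

End ConeChain.
End Acyclic.

(** * The domain in polar coordinates *)

Section Polar.
Context {R : realType}.

(** The radius is a continuous function of the angle on the whole line; only angles in [0, pi / 2]
    describe the domain. *)
Definition polar (g : R -> R) (Omega : set (R * R)) : Prop :=
  [/\ continuous g, forall x, 0 <= x <= pi / 2 -> 0 < g x
    & forall p, Omega p <-> exists x t, [/\ 0 <= x <= pi / 2, 0 <= t <= g x
         & p = (t * cos x, t * sin x)]].

Lemma star_polar (Omega : set (R * R)) :
  star_domain Omega -> exists g, polar g Omega.
Proof.
move=> [r [[g [gs rg]] r0 ->]]; exists g.
have circ x : 0 <= x <= pi / 2 -> quarter_circle (cos x, sin x) :> Prop.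
  move=> /andP[x0 xpi]; split => /=.
  - by apply: cos_ge0_pihalf; rewrite xpi andbT (le_trans _ x0)// oppr_le0 divr_ge0// pi_ge0.
  - apply: sin_ge0_pi; rewrite x0/= (le_trans xpi)// ler_pdivrMr// ler_peMr ?pi_ge0//.
    by rewrite ler1n.
  - exact: cos2Dsin2.
split.
- by move=> x; apply/differentiable_continuous/derivable1_diffP; have := gs 0%N x.
- by move=> x x01; rewrite -rg//; apply: r0; exact: circ.
move=> p; split=> [[[z1 z2] [t [[/= z10 z20 zz] tr ->]]]|[x [t [x01 tg ->]]]].
  have z11 : -1 <= z1 <= 1.
    by apply/andP; split; [lra|rewrite -(@ler_pXn2r _ 2)// ?nnegrE ?ler01// expr1n; nra].
  exists (acos z1), t.
  have cz : cos (acos z1) = z1 by apply: acosK; rewrite in_itv.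
  have sz : sin (acos z1) = z2.
    by rewrite sin_acos// -zz addrAC subrr add0r sqrtr_sqr ger0_norm.
  have az : 0 <= acos z1 <= pi / 2.
    rewrite acos_ge0//=; rewrite leNgt; apply/negP => lt.
    have : cos (acos z1) < 0.
      rewrite -(cos_pihalf R) ltr_cos// ?in_itv/= ?acos_ge0 ?acos_lepi//.
      rewrite divr_ge0 ?pi_ge0//= ler_pdivrMr// ler_peMr ?pi_ge0//.
      by rewrite ler1n.
    by rewrite cz ltNge z10.
  by split => //=; rewrite ?cz ?sz// -rg// cz sz.
by exists (cos x, sin x), t; split => //; [exact: circ|rewrite rg].
Qed.

(** Here s is the radius relative to the boundary: for angles x in the open quarter, s = 1 traces
    the outer boundary of Omega and s > 1 its open complement. *)
Definition ray (g : R -> R) (s x : R) : R * R := (s * g x * cos x, s * g x * sin x).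

(** The smaller of the two axis intercepts. *)
Definition corner (g : R -> R) : R := Num.min (g 0) (g (pi / 2)).

(** Positive, for points of the quadrant, exactly when q lies counterclockwise from p. *)
Definition cross (p q : R * R) : R := p.1 * q.2 - p.2 * q.1.

End Polar.

(** * Consequences of convexity *)

Section Geometry.
Context {R : realType} {g : R -> R} {Omega : set (R * R)}.
Hypothesis gOmega : polar g Omega.
Hypothesis Omega_convex : weakly_convex Omega.

Let pi2_gt0 : 0 < pi / 2 :> R. Proof. by rewrite divr_gt0 ?pi_gt0. Qed.
Let pi2_lepi : pi / 2 <= pi :> R.
Proof. by have := pi_gt0 R; lra. Qed.

Lemma cos_ge0_quarter (x : R) : 0 <= x <= pi / 2 -> 0 <= cos x.
Proof. by move=> /andP[? ?]; apply: cos_ge0_pihalf; apply/andP; split; lra. Qed.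
Lemma sin_ge0_quarter (x : R) : 0 <= x <= pi / 2 -> 0 <= sin x.
Proof. by move=> /andP[? ?]; apply: sin_ge0_pi; apply/andP; split; lra. Qed.
Lemma cos_gt0_quarter (x : R) : 0 < x < pi / 2 -> 0 < cos x.
Proof. by move=> /andP[? ?]; apply: cos_gt0_pihalf; apply/andP; split; lra. Qed.
Lemma sin_gt0_quarter (x : R) : 0 < x < pi / 2 -> 0 < sin x.
Proof. by move=> /andP[? ?]; apply: sin_gt0_pi; apply/andP; split; lra. Qed.

Lemma ray_in (s x : R) : 0 <= x <= pi / 2 -> 0 <= s <= 1 -> Omega (ray g s x).
Proof.
case: gOmega => _ g0 OE x01 /andP[s0 s1]; apply/OE; exists x, (s * g x).
by split => //; have := g0 _ x01; move=> ?; apply/andP; split; nra.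
Qed.

Lemma ray_le1 (s x : R) : 0 <= x <= pi / 2 -> Omega (ray g s x) -> s <= 1.
Proof.
case: gOmega => _ g0 OE x01 /OE[y [t [y01 /andP[t0 tg] []]]].
have gx := g0 _ x01; have [s0|s0 E1 E2] := leP s 0; first by lra.
have st : s * g x = t.
  have : (s * g x) ^+ 2 = t ^+ 2.
    rewrite -[LHS]mulr1 -(cos2Dsin2 x) -[RHS]mulr1 -(cos2Dsin2 y).
    by rewrite !mulrDr -!exprMn E1 E2.
  by move/eqP; rewrite eqrXn2// => [/eqP //|]; nra.
have t_gt0 : 0 < t by rewrite -st; nra.
have : cos x = cos y.
  by apply: (@mulfI _ t); [rewrite gt_eqF|rewrite -E1 st].
move/cos_inj; rewrite !in_itv/= => xy.
have {}xy : x = y.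
  apply: xy; [move: x01 => /andP[? ?]|move: y01 => /andP[? ?]]; apply/andP; split; lra.
by rewrite -xy -st ger_pMl in tg.
Qed.

Lemma Omega_ge0 p : Omega p -> 0 <= p.1 /\ 0 <= p.2.
Proof.
case: gOmega => _ g0 OE /OE[x [t [x01 /andP[t0 _] ->]]] /=.
by split; apply: mulr_ge0 => //; [exact: cos_ge0_quarter|exact: sin_ge0_quarter].
Qed.

Lemma Omega_conv p q l : Omega p -> Omega q -> 0 <= l <= 1 ->
  Omega (l * p.1 + (1 - l) * q.1, l * p.2 + (1 - l) * q.2).
Proof.
move=> Op Oq l01.
have := @Omega_convex p q (Itv01 (proj1 (andP l01)) (proj2 (andP l01))).
rewrite !inE => /(_ Op Oq); rewrite /conv /=.
exact.
Qed.

Lemma Omega_star t p : Omega p -> 0 <= t <= 1 -> Omega (t * p.1, t * p.2).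
Proof.
case: gOmega => _ g0 OE /OE[x [s [x01 /andP[s0 sg] ->]]] /andP[t0 t1] /=.
apply/OE; exists x, (t * s); rewrite !mulrA; split => //.
by apply/andP; split; nra.
Qed.

Lemma notin_scale t y : ~ Omega y -> Omega (t * y.1, t * y.2) -> t <= 1.
Proof.
move=> Oy Ot; rewrite leNgt; apply/negP => t1; apply: Oy.
have := Omega_star t^-1 _ Ot; rewrite invr_ge0 invf_le1; last by lra.
rewrite (ltW t1) (le_trans ler01 (ltW t1))/= !mulrA mulVf ?gt_eqF//; last by lra.
by rewrite !mul1r; case: y {Ot} => ? ? /(_ isT).
Qed.

(* The identity [cross w q * y = cross y q * w + cross w y * q] writes the
   point of the segment [w, q] on the ray of y. *)
Lemma sector_le (m1 m2 : int) (w q y : R * R) (e : R) :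
  Omega w -> Omega q -> 0 < y.1 -> 0 <= cross y q -> 0 <= cross w y ->
  0 < cross y q + cross w y -> 0 < e ->
  e <= A_form m1 m2 w -> e <= A_form m1 m2 q ->
  (forall t, Omega (t * y.1, t * y.2) -> t <= 1) -> e <= A_form m1 m2 y.
Proof.
move=> Ow Oq y0; set a := cross y q; set b := cross w y => a0 b0 ab0 e0 ew eq ty.
have [w0 _] := Omega_ge0 w Ow; have [q0 _] := Omega_ge0 q Oq.
have E1 : cross w q * y.1 = a * w.1 + b * q.1 by rewrite /a /b /cross; ring.
have E2 : cross w q * y.2 = a * w.2 + b * q.2 by rewrite /a /b /cross; ring.
have c0 : 0 <= cross w q.
  by rewrite -(@pmulr_lge0 _ y.1)// E1 addr_ge0// mulr_ge0.
pose t := cross w q / (a + b).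
have abn0 : a + b != 0 by rewrite gt_eqF.
have t1 : t <= 1.
  apply: ty; have := Omega_conv w q (a / (a + b)) Ow Oq.
  rewrite divr_ge0// ?(ltW ab0)// ler_pdivrMr// mul1r lerDl b0 => /(_ isT).
  have -> : t * y.1 = (a * w.1 + b * q.1) / (a + b) by rewrite -E1 /t mulrAC.
  have -> : t * y.2 = (a * w.2 + b * q.2) / (a + b) by rewrite -E2 /t mulrAC.
  by congr (Omega (_, _)); field.
have t0 : 0 <= t by rewrite divr_ge0// ltW.
have tA : e <= t * A_form m1 m2 y.
  have -> : t * A_form m1 m2 y = (a * A_form m1 m2 w + b * A_form m1 m2 q) / (a + b).
    transitivity ((m1%:~R * (cross w q * y.1) + m2%:~R * (cross w q * y.2)) / (a + b)).
      by rewrite /A_form /t; field.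
    by rewrite E1 E2 /A_form; congr (_ / _); ring.
  by rewrite ler_pdivlMr// mulrC mulrDl lerD// ler_wpM2l.
(* If the form at y were below e, then t times it being at least e > 0 with 0 <= t <= 1 would be
   contradictory. *)
have [//|Ae] := leP e (A_form m1 m2 y).
have [An|Ap] := leP (A_form m1 m2 y) 0; nra.
Qed.

Lemma corner_gt0 : 0 < corner g.
Proof.
case: gOmega => _ g0 _; rewrite lt_min !g0// ?lexx ?(ltW pi2_gt0)//.
Qed.

Lemma Omega_e1 t : 0 <= t <= g 0 -> Omega (t, 0).
Proof.
case: gOmega => _ _ OE tg; apply/OE; exists 0, t.
by rewrite lexx ltW//= cos0 sin0 mulr1 mulr0.
Qed.

Lemma Omega_e2 t : 0 <= t <= g (pi / 2) -> Omega (0, t).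
Proof.
case: gOmega => _ _ OE tg; apply/OE; exists (pi / 2), t.
by rewrite lexx ltW//= cos_pihalf sin_pihalf mulr1 mulr0.
Qed.

(** The point lies on the segment joining the axis points (y_1 + y_2, 0) and (0, y_1 + y_2), both in
    Omega. *)
Lemma triangle_in y : 0 <= y.1 -> 0 <= y.2 -> y.1 + y.2 <= corner g -> Omega y.
Proof.
case: y => y1 y2 /= y10 y20 yc.
have c0 := corner_gt0.
have ca : corner g <= g 0 by rewrite ge_min lexx.
have cb : corner g <= g (pi / 2) by rewrite ge_min lexx orbT.
have [s0|s0] := leP (y1 + y2) 0.
  have -> : y1 = 0 by lra.
  have -> : y2 = 0 by lra.
  by apply: Omega_e1; rewrite lexx ltW// (lt_le_trans c0).
have := Omega_conv (y1 + y2, 0) (0, y1 + y2) (y1 / (y1 + y2)).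
rewrite /= !mulr0 addr0 add0r mulrBl mul1r divfK ?gt_eqF// addrAC subrr add0r.
apply; [apply: Omega_e1|apply: Omega_e2|]; apply/andP; split; try lra.
  by rewrite divr_ge0// ltW.
by rewrite ler_pdivrMr// mul1r lerDl.
Qed.

(** A form with nonnegative coefficients is largest at the end of each ray, so it suffices to
    maximise over the angle. *)
Lemma max_A_form (j l : nat) : exists2 p, Omega p &
  forall q, Omega q -> A_form j l q <= A_form j l p :> R.
Proof.
case: gOmega => cg g0 OE.
pose h x := g x * (j%:R * cos x + l%:R * sin x).
have ch : continuous h.
  move=> x; apply: cvgM; first exact: cg.
  by apply: cvgD; apply: cvgM; [exact: cvg_cst|exact: continuous_cos|
    exact: cvg_cst|exact: continuous_sin].
have [x x01 hx] := @EVT_max R h 0 (pi / 2) (ltW pi2_gt0)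
  (continuous_subspaceT ch).
rewrite in_itv/= in x01.
exists (ray g 1 x); first by apply: ray_in => //; rewrite ler01 lexx.
move=> q /OE[y [t [y01 /andP[t0 tg] ->]]].
have := hx y; rewrite in_itv/= => /(_ y01) hyx; apply: (@le_trans _ _ (h y)); last apply: (le_trans hyx).
  rewrite /A_form /= /h -!pmulrn.
  have := cos_ge0_quarter _ y01; have := sin_ge0_quarter _ y01.
  have : 0 <= j%:R :> R by []. have : 0 <= l%:R :> R by [].
  move=> l0 j0 s0 c0.
  have : 0 <= (j%:R * cos y + l%:R * sin y) by rewrite addr_ge0// mulr_ge0.
  nra.
rewrite /A_form /= /h -!pmulrn mul1r le_eqVlt; apply/orP; left; apply/eqP; ring.
Qed.

End Geometry.

(** * The polar chart; acyclicity of the complement and of its low sublevel sets *)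

Section Chart.
Context {R : realType} {g : R -> R} {Omega : set (R * R)}.
Hypothesis gOmega : polar g Omega.

(** The inverse of (x, s) -> [ray f s x] on the open quadrant. *)
Definition chart (f : R -> R) (y : R * R) : R * R :=
  (atan (y.2 / y.1), y.1 / (cos (atan (y.2 / y.1)) * f (atan (y.2 / y.1)))).

Let pi2_gt0 : 0 < pi / 2 :> R. Proof. by rewrite divr_gt0 ?pi_gt0. Qed.
Let g_gt0 x : 0 < x < pi / 2 -> 0 < g x.
Proof.
by case: gOmega => _ g0 _ /andP[? ?]; apply: g0; apply/andP; split; exact: ltW.
Qed.

Lemma chart_itv y : 0 < y.1 -> 0 < y.2 -> 0 < (chart g y).1 < pi / 2.
Proof.
by move=> y1 y2; rewrite /= -{1}(atan0 R) lt_atan ?divr_gt0//= atan_ltpi2.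
Qed.

Lemma chartK y : 0 < y.1 -> 0 < y.2 -> ray g (chart g y).2 (chart g y).1 = y.
Proof.
move=> y1 y2; have := chart_itv y y1 y2.
rewrite /ray /=; set x := atan _ => x01.
have cx := cos_gt0_quarter _ x01; have gx := g_gt0 _ x01.
have sx : sin x = y.2 / y.1 * cos x.
  by rewrite -[y.2 / y.1]atanK -/x /tan divfK// gt_eqF.
by case: y y1 y2 @x x01 cx gx sx => a b /= a0 b0 x01 cx gx ->; congr pair;
  field; rewrite ?gt_eqF.
Qed.

Lemma open_complement_ray s x : 0 < x < pi / 2 -> 1 < s ->
  open_complement Omega (ray g s x).
Proof.
move=> x01 s1; have gx := g_gt0 _ x01; have s0 : 0 < s by lra.
split; rewrite /=; [|have := cos_gt0_quarter _ x01|]; rewrite ?mulr_gt0 ?cos_gt0_quarter ?sin_gt0_quarter//.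
have x01' : 0 <= x <= pi / 2 by case/andP: x01 => ? ?; apply/andP; split; exact: ltW.
by move=> /(ray_le1 gOmega _ _ x01'); rewrite leNgt s1.
Qed.

Lemma open_complement_chart y : open_complement Omega y ->
  0 < (chart g y).1 < pi / 2 /\ 1 < (chart g y).2.
Proof.
move=> [y1 y2 Oy]; have x01 := chart_itv y y1 y2; split => //.
rewrite ltNge; apply/negP => s1; apply: Oy; rewrite -(chartK y y1 y2).
apply: (ray_in gOmega); first by case/andP: x01 => ? ?; apply/andP; split; exact: ltW.
by rewrite s1 andbT /= divr_ge0 ?mulr_ge0 ?ltW// ?g_gt0// cos_gt0_quarter.
Qed.

Lemma continuous_ray (s : R) : continuous (ray g s).
Proof.
case: gOmega => cg _ _ x; have FF : Filter (nbhs x) by exact: nbhs_filter.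
apply: (@cvg_pair _ _ _ (nbhs x) (nbhs _) (nbhs _) FF); apply: cvgM.
- by apply: cvgM; [exact: cvg_cst|exact: cg].
- exact: continuous_cos.
- by apply: cvgM; [exact: cvg_cst|exact: cg].
- exact: continuous_sin.
Qed.

Lemma continuous_ray2 : continuous (fun x : R * R => ray g x.2 x.1).
Proof.
case: gOmega => cg _ _ x; have FF : Filter (nbhs x) by exact: nbhs_filter.
have cg1 : g u.1 @[u --> x] --> g x.1.
  by apply: (@continuous_comp _ _ _ fst g); [exact: cvg_fst|exact: cg].
apply: (@cvg_pair _ _ _ (nbhs x) (nbhs _) (nbhs _) FF); apply: (@cvgM _ _ _ FF).
- by apply: (@cvgM _ _ _ FF) => //; exact: cvg_snd.
- by apply: (@continuous_comp _ _ _ fst cos); [exact: cvg_fst|exact: continuous_cos].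
- by apply: (@cvgM _ _ _ FF) => //; exact: cvg_snd.
- by apply: (@continuous_comp _ _ _ fst sin); [exact: cvg_fst|exact: continuous_sin].
Qed.

Lemma continuous_chart y : 0 < y.1 -> 0 < y.2 ->
  {for y, continuous (fun u => (chart g u).1)} /\
  {for y, continuous (fun u => (chart g u).2)}.
Proof.
move=> y1 y2; have FF : Filter (nbhs y) by exact: nbhs_filter.
have c1 : {for y, continuous (fun u => (chart g u).1)}.
  apply: (@continuous_comp _ _ _ (fun u : R * R => u.2 / u.1) atan).
    apply: (@cvgM _ _ _ FF); first exact: cvg_snd.
    by apply: cvgV; [rewrite gt_eqF|exact: cvg_fst].
  exact: continuous_atan.
split => //; apply: (@cvgM _ _ _ FF); first exact: cvg_fst.
have x01 := chart_itv y y1 y2; case: gOmega => cg _ _.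
apply: cvgV; first by rewrite gt_eqF// mulr_gt0 ?g_gt0 ?cos_gt0_quarter.
apply: (@cvgM _ _ _ FF).
  by apply: (@continuous_comp _ _ _ (fun u => (chart g u).1) cos); [exact: c1|exact: continuous_cos].
by apply: (@continuous_comp _ _ _ (fun u => (chart g u).1) g); [exact: c1|exact: cg].
Qed.

Lemma near0_lt (h : R -> R) (e : R) : continuous h -> h 0 < e ->
  exists2 x, 0 < x < pi / 2 & forall u, 0 <= u <= x -> h u < e.
Proof.
move=> ch h0.
have /(ch 0) : nbhs (h 0) [set v | v < e] by exact: (open_nbhs_nbhs (conj (@open_lt _ e) h0)).
move=> /nbhs_ballP[d /= d0 dh].
exists (Num.min (d / 2) (pi / 4)).
  by rewrite lt_min gt_min; have := pi_gt0 R; move=> ?; apply/andP; split; [apply/andP; split|apply/orP; right]; lra.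
move=> u /andP[u0]; rewrite le_min => /andP[ud _]; apply: dh.
by rewrite /ball/= sub0r normrN ger0_norm//; lra.
Qed.

Lemma near_pi2_lt (h : R -> R) (e : R) : continuous h -> h (pi / 2) < e ->
  exists2 x, 0 < x < pi / 2 & forall u, x <= u <= pi / 2 -> h u < e.
Proof.
move=> ch he.
have [||x /andP[x0 x1] xh] := @near0_lt (fun u => h (pi / 2 - u)) e.
- move=> u; apply: (@continuous_comp _ _ _ (fun u => pi / 2 - u) h).
    by apply: cvgB; [exact: cvg_cst|exact: cvg_id].
  exact: ch.
- by rewrite subr0.
exists (pi / 2 - x); first by apply/andP; split; lra.
move=> u /andP[u0 u1]; have := xh (pi / 2 - u); rewrite subKr.
by apply; apply/andP; split; lra.
Qed.

Lemma continuous_A_ray m1 m2 s : continuous (fun x => A_form m1 m2 (ray g s x)).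
Proof.
case: gOmega => cg _ _ x; apply: cvgD; apply: cvgM; try exact: cvg_cst.
- apply: cvgM; last exact: continuous_cos.
  by apply: cvgM; [exact: cvg_cst|exact: cg].
- apply: cvgM; last exact: continuous_sin.
  by apply: cvgM; [exact: cvg_cst|exact: cg].
Qed.

Lemma A_form_scale m1 m2 t (y : R * R) :
  A_form m1 m2 (t * y.1, t * y.2) = t * A_form m1 m2 y.
Proof. by rewrite /A_form /=; ring. Qed.

Lemma ray_scale t s x : ray g (t * s) x = (t * (ray g s x).1, t * (ray g s x).2).
Proof. by rewrite /ray /= !mulrA. Qed.

Lemma cross_ray s s' x x' :
  cross (ray g s x) (ray g s' x') = s * g x * (s' * g x') * sin (x' - x).
Proof. by rewrite sinB /cross /ray /=; ring. Qed.

(** In the chart the complement is the product of 0 < x < pi / 2 and s > 1, so it contains the boxes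
    required by [acyclic_chart]. *)
Lemma acyclic_open_complement : acyclic (open_complement Omega).
Proof.
apply: (@acyclic_chart _ (fun x : R * R => ray g x.2 x.1) (chart g)).
- exact: continuous_ray2.
- by move=> y [y1 y2 _]; exact: continuous_chart.
- by move=> y [y1 y2 _]; exact: chartK.
- exists (ray g 2 (pi / 4)); apply: open_complement_ray; last by lra.
  by have := pi_gt0 R; move=> ?; apply/andP; split; lra.
move=> y y1 y2 a b /open_complement_chart[/andP[_ yx] _].
move=> /open_complement_chart[/andP[y1x _] _].
move=> /open_complement_chart[_ y2s] /andP[? ?] /andP[? _].
by apply: open_complement_ray => /=; [apply/andP; split|]; lra.
Qed.

Hypothesis Omega_convex : weakly_convex Omega.

Section Sublevel.
Variables (d : R) (m : int * int).
Hypotheses (d0 : 0 < d) (dc : d <= corner g).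

Let sub := sublevel Omega d%:E m.

Let sub_ray s x : 0 < x < pi / 2 -> 1 < s -> A_form m.1 m.2 (ray g s x) < d ->
  sub (ray g s x).
Proof. by move=> x01 s1 Ad; split; [exact: open_complement_ray|rewrite lte_fin]. Qed.

Let itvW (x : R) : 0 < x < pi / 2 -> 0 <= x <= pi / 2.
Proof. by case/andP=> ? ?; apply/andP; split; exact: ltW. Qed.

(** The sublevel set survives a decrease of s to s' together with a rotation away from q. Otherwise
    the boundary point w in the new direction and q would both have form at least d / s', and so
    would y, which lies in their sector and not inside Omega; scaling y by s' contradicts the
    hypothesis. *)
Let sector_ray (q : R * R) s x s' x' (y := ray g (s / s') x) (w := ray g 1 x') :
  0 < x < pi / 2 -> 0 < x' < pi / 2 ->
  Omega q -> d <= A_form m.1 m.2 q -> 1 < s' <= s ->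
  (0 < cross y q /\ 0 <= cross w y) \/ (0 < cross q y /\ 0 <= cross y w) ->
  A_form m.1 m.2 (ray g s x) < d -> A_form m.1 m.2 (ray g s' x') < d.
Proof.
move=> x01 x01' Oq dq /andP[s'1 s's] qy Ad; rewrite ltNge; apply/negP => dA.
have s'0 : 0 < s' by lra.
have Ow : Omega w by apply: (ray_in gOmega); [exact: itvW|rewrite ler01 lexx].
have dw : d / s' <= A_form m.1 m.2 w.
  rewrite ler_pdivrMr// mulrC -A_form_scale /w -ray_scale mulr1.
  exact: dA.
have dq' : d / s' <= A_form m.1 m.2 q.
  by apply: le_trans dq; rewrite ler_pdivrMr// ler_peMr ?ltW.
have y1 : 0 < y.1.
  by rewrite /y /= !mulr_gt0 ?cos_gt0_quarter ?g_gt0// ?invr_gt0//; lra.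
have ty t : Omega (t * y.1, t * y.2) -> t <= 1.
  rewrite /y -ray_scale => /(ray_le1 gOmega _ _ (itvW _ x01)).
  rewrite mulrA ler_pdivrMr// mul1r => ts.
  by rewrite -(@ler_pM2r _ s) ?mul1r; lra.
have d'0 : 0 < d / s' by rewrite divr_gt0.
suff : d / s' <= A_form m.1 m.2 y.
  rewrite ler_pdivrMr// mulrC -A_form_scale -ray_scale mulrCA divff ?gt_eqF// mulr1.
  by rewrite leNgt Ad.
case: qy => [[yq wy]|[qy yw]].
  by apply: (sector_le gOmega Omega_convex _ _ w q) => //; lra.
by apply: (sector_le gOmega Omega_convex _ _ q w) => //; lra.
Qed.

Let sub_neq0 (h0 : A_form m.1 m.2 (ray g 2 0) < d \/
    A_form m.1 m.2 (ray g 2 (pi / 2)) < d) : sub !=set0.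
Proof.
case: h0 => h0.
  have [x x01 xd] := near0_lt _ _ (continuous_A_ray m.1 m.2 2) h0.
  exists (ray g 2 x); apply: sub_ray => //; first by lra.
  by apply: xd; case/andP: x01 => ? ?; apply/andP; split; lra.
have [x x01 xd] := near_pi2_lt _ _ (continuous_A_ray m.1 m.2 2) h0.
exists (ray g 2 x); apply: sub_ray => //; first by lra.
by apply: xd; case/andP: x01 => ? ?; apply/andP; split; lra.
Qed.

Let g0_gt0 : 0 < g 0.
Proof. by case: gOmega => _ gp _; apply: gp; rewrite lexx ltW. Qed.
Let gpi_gt0 : 0 < g (pi / 2).
Proof. by case: gOmega => _ gp _; apply: gp; rewrite lexx ltW. Qed.

Let in_sub y : sub y -> [/\ 0 < y.1, 0 < y.2, 0 < (chart g y).1 < pi / 2,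
  1 < (chart g y).2 & A_form m.1 m.2 (ray g (chart g y).2 (chart g y).1) < d].
Proof.
move=> [Uy]; rewrite lte_fin => Ay; have [? ?] := open_complement_chart y Uy.
by case: Uy => y1 y2 _; split; rewrite ?chartK.
Qed.

(** At the intercept q on the second axis the form is at least d, because m_2 >= 1 and d <=
    [corner]. Hence angle and relative radius may be decreased inside the sublevel set, which is
    nonempty because the form is nonpositive on the first axis. *)
Lemma acyclic_sublevel_lower : m.1 <= 0 -> 0 < m.2 -> acyclic sub.
Proof.
move=> m1 m2; apply: (@acyclic_chart _ (fun x : R * R => ray g x.2 x.1) (chart g)).
- exact: continuous_ray2.
- by move=> y [[y1 y2 _] _]; exact: continuous_chart.
- by move=> y [[y1 y2 _] _]; exact: chartK.
- apply: sub_neq0; left; rewrite /A_form /ray /= cos0 sin0 mulr0 mulr0 addr0 mulr1.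
  apply: le_lt_trans d0; rewrite mulr_le0_ge0 ?mulr_ge0 ?(ltW g0_gt0)//.
  by rewrite lerz0.
move=> y y1 y2 a b /in_sub[_ _ /andP[y0 ypi] ys Ay].
move=> /in_sub[_ _ /andP[y10 _] _ _] /in_sub[_ _ _ y2s _].
move=> /andP[ya ay] /andP[yb bs].
have a01 : 0 < a < pi / 2 by apply/andP; split; lra.
have b1 : 1 < b by lra.
apply: sub_ray => //=.
have gp := gpi_gt0.
apply: (@sector_ray (0, g (pi / 2)) (chart g y).2 (chart g y).1) => //.
- by rewrite y0.
- by apply: (Omega_e2 gOmega); rewrite lexx ltW.
- rewrite /A_form /= mulr0 add0r.
  apply: (@le_trans _ _ (g (pi / 2))).
    by apply: le_trans dc _; rewrite /corner ge_min lexx orbT.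
  by rewrite ler_peMl ?(ltW gp)// ler1z -gtz0_ge1.
- by rewrite b1.
have r0 : 0 < (chart g y).2 / b * g (chart g y).1.
  by apply: mulr_gt0; [apply: divr_gt0; lra|apply: g_gt0; rewrite y0].
left; split.
  rewrite /cross /= mulr0 subr0 mulr_gt0// mulr_gt0 ?cos_gt0_quarter ?y0//.
rewrite cross_ray mul1r; apply: mulr_ge0.
  by apply: mulr_ge0; apply: ltW => //; exact: g_gt0.
by apply: sin_ge0_quarter; move: (andP a01) => [? ?]; apply/andP; split; lra.
Qed.

(** The mirror image: q is on the first axis and angles may be increased, so the chart carries the
    negated angle. *)
Lemma acyclic_sublevel_upper : 0 < m.1 -> m.2 <= 0 -> acyclic sub.
Proof.
move=> m1 m2; apply: (@acyclic_chart _ (fun x : R * R => ray g x.2 (- x.1))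
  (fun y => (- (chart g y).1, (chart g y).2))).
- move=> x; apply: (@continuous_comp _ _ _ (fun x : R * R => (- x.1, x.2))
    (fun x : R * R => ray g x.2 x.1)); last exact: continuous_ray2.
  have FF : Filter (nbhs x) by exact: nbhs_filter.
  apply: (@cvg_pair _ _ _ (nbhs x) (nbhs _) (nbhs _) FF); last exact: cvg_snd.
  by apply: (@cvgN _ _ _ _ FF); exact: cvg_fst.
- move=> y [[y1 y2 _] _]; have [c1 c2] := continuous_chart y y1 y2; split => //=.
  have FF : Filter (nbhs y) by exact: nbhs_filter.
  by apply: (@cvgN _ _ _ _ FF); exact: c1.
- by move=> y [[y1 y2 _] _]; rewrite /= opprK; exact: chartK.
- apply: sub_neq0; right.
  rewrite /A_form /ray /= cos_pihalf sin_pihalf !mulr0 add0r mulr1.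
  apply: le_lt_trans d0; rewrite mulr_le0_ge0 ?mulr_ge0 ?(ltW gpi_gt0)//.
  by rewrite lerz0.
move=> y y1 y2 a b /in_sub[_ _ /andP[y0 ypi] ys Ay].
move=> /in_sub[_ _ /andP[_ y1pi] _ _] /in_sub[_ _ _ y2s _] ya yb.
have {ya} /andP[ya ay] : - (chart g y1).1 <= a <= - (chart g y).1 := ya.
have {yb} /andP[yb bs] : (chart g y2).2 <= b <= (chart g y).2 := yb.
have a01 : 0 < - a < pi / 2 by apply/andP; split; lra.
have b1 : 1 < b by lra.
apply: sub_ray => //=.
have gp := g0_gt0.
apply: (@sector_ray (g 0, 0) (chart g y).2 (chart g y).1) => //.
- by rewrite y0.
- by apply: (Omega_e1 gOmega); rewrite lexx ltW.
- rewrite /A_form /= mulr0 addr0.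
  apply: (@le_trans _ _ (g 0)).
    by apply: le_trans dc _; rewrite /corner ge_min lexx.
  by rewrite ler_peMl ?(ltW gp)// ler1z -gtz0_ge1.
- by rewrite b1.
have r0 : 0 < (chart g y).2 / b * g (chart g y).1.
  by apply: mulr_gt0; [apply: divr_gt0; lra|apply: g_gt0; rewrite y0].
right; split.
  by rewrite /cross /= mul0r subr0 mulr_gt0// mulr_gt0 ?sin_gt0_quarter ?y0.
rewrite cross_ray mul1r; apply: mulr_ge0.
  by apply: mulr_ge0; apply: ltW => //; exact: g_gt0.
by apply: sin_ge0_quarter; move: (andP a01) => [? ?]; apply/andP; split; lra.
Qed.

(** Coefficients at least 1 make the form dominate y_1 + y_2, which puts the sublevel set inside the
    triangle contained in Omega. *)
Lemma sublevel_empty : 0 < m.1 -> 0 < m.2 -> sub = set0.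
Proof.
move=> m1 m2; apply/seteqP; split => // y [[y1 y2 Oy]]; rewrite lte_fin => Ad.
apply: Oy; apply: (triangle_in gOmega Omega_convex); [exact: ltW..|].
apply: (le_trans _ dc); apply: (le_trans _ (ltW Ad)).
have i1 : (1 : R) <= m.1%:~R by rewrite ler1z -gtz0_ge1.
have i2 : (1 : R) <= m.2%:~R by rewrite ler1z -gtz0_ge1.
by rewrite /A_form; nra.
Qed.

End Sublevel.
End Chart.

Lemma subr_subr_cancel (V : zmodType) (p q u v : V) :
  p - q = u - v - (u - p - (v - q)).
Proof.
have -> : u - p - (v - q) = u - v - (p - q) by rewrite opprD addrACA -opprD.
by rewrite subKr.
Qed.

(** * The filtered complex and its relative homology classes *)

Section Complex.
Context {R : realType}.
Implicit Types (Omega : set (R * R)) (a b : \bar R) (d : int)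
  (x y : chain_family R) (m : int * int).

Lemma chain_familyD x y m : (x + y) m = ((x m).1 + (y m).1, (x m).2 + (y m).2).
Proof. by []. Qed.

Lemma chain_familyN x m : (- x) m = (- (x m).1, - (x m).2).
Proof. by []. Qed.

Lemma chain_family0 m : (0 : chain_family R) m = (0, 0).
Proof. by []. Qed.

Lemma bdB d x y : bd d (x - y) = bd d x - bd d y.
Proof.
apply/funext => m; rewrite [RHS]chain_familyD chain_familyN /bd.
case: ifP => _; last by rewrite /= subrr.
rewrite !chain_familyD !chain_familyN [RHS]/= [in LHS]/=; congr pair; first exact: sing_bdB.
rewrite sing_bdB opprD addrACA -scalerBr; congr (_ + _ *: _).
by rewrite !scalerBr !opprB addrACA [RHS]addrACA; congr (_ + _); rewrite addrC.
Qed.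

Lemma bd0 d : bd d (0 : chain_family R) = 0.
Proof. by rewrite -{1}(subrr 0) bdB subrr. Qed.

Lemma bdN d x : bd d (- x) = - bd d x.
Proof. by rewrite -sub0r bdB bd0 sub0r. Qed.

Lemma bdD d x y : bd d (x + y) = bd d x + bd d y.
Proof. by rewrite -{1}[y]opprK bdB bdN opprK. Qed.

(** The coordinates are positive on the complement, so forms grow with their coefficients; this is
    why [bd], which moves chains from (m_1 + 1, m_2) and (m_1, m_2 + 1) to m, respects levels. *)
Lemma sublevelS Omega a b m m' : (a <= b)%E -> m'.1 <= m.1 -> m'.2 <= m.2 ->
  sublevel Omega a m `<=` sublevel Omega b m'.
Proof.
move=> ab m1 m2 y [Uy Ay]; split => //; apply: le_lt_trans (lt_le_trans Ay ab).
rewrite lee_fin /A_form; have [y1 y2 _] := Uy.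
by apply: lerD; rewrite ler_wpM2r ?ler_int// ltW.
Qed.

Lemma sublevel_oo Omega m : sublevel Omega +oo%E m = open_complement Omega.
Proof. by apply/seteqP; split => [y []//|y Uy]; split => //; rewrite ltry. Qed.

Lemma domain0 Omega a d : domain_complex Omega a d 0.
Proof.
split=> //; last by move=> m _; split; exact: chains_in0.
by rewrite (_ : [set _ | _] = set0)//; apply/seteqP; split.
Qed.

Lemma domainN Omega a d x : domain_complex Omega a d x ->
  domain_complex Omega a d (- x).
Proof.
move=> [fx x0 xC]; split.
- apply: sub_finite_set fx => m /=; rewrite chain_familyN => xm xm0; apply: xm.
  by rewrite xm0 /= oppr0.
- by move=> m mI; rewrite chain_familyN x0//= oppr0.
- by move=> m mI; have [? ?] := xC m mI; split; exact: chains_inN.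
Qed.

Lemma domainD Omega a d x y : domain_complex Omega a d x ->
  domain_complex Omega a d y -> domain_complex Omega a d (x + y).
Proof.
move=> [fx x0 xC] [fy y0 yC]; split.
- have : finite_set ([set m | x m <> 0] `|` [set m | y m <> 0]).
    by rewrite finite_setU.
  apply: sub_finite_set => m /= xym; have [xm|] := pselect (x m = 0); last by left.
  right => ym; apply: xym; rewrite chain_familyD xm ym /=; by rewrite addr0.
- by move=> m mI; rewrite chain_familyD x0// y0//= addr0.
- by move=> m mI; have [? ?] := xC m mI; have [? ?] := yC m mI;
    split; exact: chains_inD.
Qed.

Lemma domainS Omega a b d x : (a <= b)%E -> domain_complex Omega a d x ->
  domain_complex Omega b d x.
Proof.
move=> ab [fx x0 xC]; split => // m mI; have [? ?] := xC m mI.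
by split; apply: chains_inS; [exact: sublevelS ab _ _|by []|exact: sublevelS ab _ _|by []].
Qed.

Lemma rel_boundaries0 Omega a b d : rel_boundaries Omega a b d 0.
Proof.
split; first exact: domain0.
by exists 0; [exact: domain0|rewrite bd0 subr0; exact: domain0].
Qed.

Lemma rel_boundariesD Omega a b d x y : rel_boundaries Omega a b d x ->
  rel_boundaries Omega a b d y -> rel_boundaries Omega a b d (x + y).
Proof.
move=> [Dx [u Du xu]] [Dy [v Dv yv]]; split; first exact: domainD.
exists (u + v); first exact: domainD.
by rewrite bdD opprD addrACA; exact: domainD.
Qed.

Lemma rel_boundariesN Omega a b d x : rel_boundaries Omega a b d x ->
  rel_boundaries Omega a b d (- x).
Proof.
move=> [Dx [u Du xu]]; split; first exact: domainN.
by exists (- u); [exact: domainN|rewrite bdN -opprD; exact: domainN].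
Qed.

Lemma rel_boundariesS Omega a a' b b' d x : (a <= a')%E -> (b <= b')%E ->
  rel_boundaries Omega a b d x -> rel_boundaries Omega a' b' d x.
Proof.
move=> aa bb [Dx [u Du xu]]; split; first exact: domainS Dx.
by exists u; [exact: domainS Du|exact: domainS xu].
Qed.

Lemma hclass_eq Omega a b d x y : rel_boundaries Omega a b d (x - y) ->
  hclass Omega a b d x = hclass Omega a b d y.
Proof.
move=> xy; apply/seteqP; split => z /= zB.
  by rewrite /hclass/= -(subrK x z) -addrA; exact: rel_boundariesD.
rewrite /hclass/= -(subrK y z) -addrA; apply: rel_boundariesD => //.
by rewrite -opprB; exact: rel_boundariesN.
Qed.

Lemma hclass_refl Omega a b d x : hclass Omega a b d x x.
Proof. by rewrite /hclass/= subrr; exact: rel_boundaries0. Qed.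

Lemma hmap_hclass Omega a a' b b' d x : (a <= a')%E -> (b <= b')%E ->
  hmap Omega a' b' d (hclass Omega a b d x) = hclass Omega a' b' d x.
Proof.
move=> aa bb; apply/seteqP; split => [z [y yx]|z zx]; last first.
  by exists x => //; exact: hclass_refl.
by rewrite (hclass_eq _ _ _ _ y x)//; exact: rel_boundariesS yx.
Qed.

Lemma bd_finite d x : finite_set [set m | x m <> 0] ->
  finite_set [set m | bd d x m <> 0].
Proof.
move=> fx.
have : finite_set ([set m | x m <> 0] `|`
   ((fun m => (m.1 - 1, m.2)) @` [set m | x m <> 0] `|`
    (fun m => (m.1, m.2 - 1)) @` [set m | x m <> 0])).
  by rewrite !finite_setU; split => //; split; exact: finite_image.
apply: sub_finite_set => -[m1 m2] /= bm.
have [xm|] := pselect (x (m1, m2) = 0); last by left.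
right; have [xm1|xm1] := pselect (x (m1 + 1, m2) = 0); last first.
  by left; exists (m1 + 1, m2) => //=; rewrite addrK.
have [xm2|xm2] := pselect (x (m1, m2 + 1) = 0); last first.
  by right; exists (m1, m2 + 1) => //=; rewrite addrK.
exfalso; apply: bm; rewrite /bd /=; case: ifP => // _.
by rewrite xm xm1 xm2 /= sing_bd0 !scaler0 subrr scaler0 addr0.
Qed.

End Complex.

(** * Relative cycles of weight zero bound at level infinity *)

Section Vanishing.
Context {R : realType} {g : R -> R} {Omega : set (R * R)}.
Hypothesis gOmega : polar g Omega.
Hypothesis Omega_convex : weakly_convex Omega.

Local Notation U := (open_complement Omega).

(** If a coordinate of m is nonpositive, U and its sublevel set are both acyclic and so is the pair.
    Otherwise the sublevel set is empty, c is a cycle of U, and only the weight in degree 0 can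
    obstruct. *)
Lemma fill_chain (e : R) m n c : 0 < e -> e <= corner g -> index_set m ->
  chains_in U n c -> chains_in (sublevel Omega e%:E m) (n - 1) (sing_bd c) ->
  (0 < m.1 -> 0 < m.2 -> n = 0 -> weight (cst 1) c = 0) ->
  exists2 b, chains_in U (n + 1) b
    & chains_in (sublevel Omega e%:E m) n (c - sing_bd b).
Proof.
move=> e0 ec mI cU cV c0.
have VU : sublevel Omega e%:E m `<=` U by move=> y [].
have aU := acyclic_open_complement gOmega.
have [m1|m1] := leP m.1 0.
  have m2 : 0 < m.2 by move: mI; rewrite /index_set m1/= -ltNge.
  by apply: acyclic_rel VU aU _ cU cV; exact: (acyclic_sublevel_lower gOmega Omega_convex _ _ e0 ec).
have [m2|m2] := leP m.2 0.
  by apply: acyclic_rel VU aU _ cU cV; exact: (acyclic_sublevel_upper gOmega Omega_convex _ _ e0 ec).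
have V0 := sublevel_empty gOmega Omega_convex _ _ ec m1 m2.
have c_cyc : sing_bd c = 0.
  by apply: (chains_in_set0 (n - 1)); move: cV; rewrite V0.
have [] := aU.2 n c cU c_cyc (c0 m1 m2).
by move=> b bU bc; exists b => //; rewrite bc subrr; exact: chains_in0.
Qed.

(** The e_0 components are filled by y0; after subtraction of the boundary of this filling, the e_1
    components are relative cycles, filled by y1. These have odd dimension as d is odd, so the
    weight condition concerns e_0 alone. *)
Lemma cycle_is_boundary (e : R) d x : 0 < e -> e <= corner g ->
  (forall i : int, d <> 2 * i) ->
  domain_complex Omega +oo d x -> domain_complex Omega e%:E (d - 1) (bd d x) ->
  (forall m, 0 < m.1 -> 0 < m.2 -> d + 1 - 2 * (m.1 + m.2) = 0 ->
     weight (cst 1) (x m).1 = 0) ->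
  rel_boundaries Omega e%:E +oo d x.
Proof.
move=> e0 ec dodd Dx Dbx x0; have [fx xI xC] := Dx; have [_ _ bC] := Dbx.
split => //.
(* The filling is required to be 0 wherever x is, so that the chosen family has finite support. *)
have /choice[y0 y0P] : forall m, exists b, (x m = 0 -> b = 0) /\
   (index_set m -> chains_in U (d + 1 - 2 * (m.1 + m.2) + 1) b /\
      chains_in (sublevel Omega e%:E m) (d + 1 - 2 * (m.1 + m.2)) ((x m).1 - sing_bd b)).
  move=> m; have [xm|xm] := pselect (x m = 0).
    exists 0; split => // _; rewrite xm sing_bd0 subr0.
    by split; exact: chains_in0.
  have mI : index_set m by apply: contrapT => /negP/xI.
  have [] := fill_chain e m (d + 1 - 2 * (m.1 + m.2)) (x m).1 e0 ec mI.
  - by have [] := xC m mI; rewrite sublevel_oo.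
  - have [] := bC m mI; rewrite /bd mI /= => + _.
    by congr (chains_in _ _ _); lia.
  - by move=> m1 m2 ?; exact: x0.
  by move=> b ? ?; exists b; split => // /xm.
pose y : chain_family R := fun m => (y0 m, 0).
pose x' := x - bd (d + 1) y.
have Dy : domain_complex Omega +oo (d + 1) y.
  split.
  - apply: sub_finite_set fx => m /= ym xm; apply: ym.
    by rewrite /y (proj1 (y0P m)).
  - by move=> m /xI xm; rewrite /y (proj1 (y0P m)).
  - move=> m mI; rewrite sublevel_oo; split; last exact: chains_in0.
    have [_ /(_ mI)[+ _]] := y0P m.
    by congr (chains_in _ _ _); lia.
have fx' : finite_set [set m | x' m <> 0].
  have : finite_set ([set m | x m <> 0] `|` [set m | bd (d + 1) y m <> 0]).
    by rewrite finite_setU; split => //; apply: bd_finite; case: Dy.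
  apply: sub_finite_set => m /= xym; have [xm|] := pselect (x m = 0); last by left.
  right => ym; apply: xym; rewrite /x' chain_familyD chain_familyN xm ym /=.
  by rewrite subr0.
have sgn : (-1) ^ (d + 1) = - (-1) ^ d :> rat by rewrite exprzDr ?unitrN1// mulrN1.
have x'2 m : index_set m -> chains_in U (d - 2 * (m.1 + m.2)) (x' m).2 /\
    chains_in (sublevel Omega e%:E m) (d - 2 * (m.1 + m.2) - 1) (sing_bd (x' m).2).
  move=> mI; pose n := d - 2 * (m.1 + m.2).
  have m1I : index_set (m.1 + 1, m.2) by move: mI; rewrite /index_set /=; lia.
  have m2I : index_set (m.1, m.2 + 1) by move: mI; rewrite /index_set /=; lia.
  have V1 : sublevel Omega e%:E (m.1 + 1, m.2) `<=` sublevel Omega e%:E m.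
    by apply: sublevelS => //=; rewrite lerDl.
  have V2 : sublevel Omega e%:E (m.1, m.2 + 1) `<=` sublevel Omega e%:E m.
    by apply: sublevelS => //=; rewrite lerDl.
  have x'E : (x' m).2 = (x m).2 + (-1) ^ d *:
      (m.2%:~R *: y0 (m.1 + 1, m.2) - m.1%:~R *: y0 (m.1, m.2 + 1)).
    rewrite /x' chain_familyD chain_familyN /bd mI /= sing_bd0 add0r.
    by rewrite sgn scaleNr opprK.
  rewrite x'E.
  have [_ /(_ m1I)[/= y1U y1V]] := y0P (m.1 + 1, m.2).
  have [_ /(_ m2I)[/= y2U y2V]] := y0P (m.1, m.2 + 1).
  split.
    apply: chains_inD; first by have [_] := xC m mI; rewrite sublevel_oo.
    apply: chains_inZ; apply: chains_inB; apply: chains_inZ.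
      by move: y1U; congr (chains_in _ _ _); lia.
    by move: y2U; congr (chains_in _ _ _); lia.
  (* The boundary of x' is that of x corrected by the residues of the fillings y0; all these terms
     lie in the sublevel set. *)
  have -> : sing_bd ((x m).2 + (-1) ^ d *:
      (m.2%:~R *: y0 (m.1 + 1, m.2) - m.1%:~R *: y0 (m.1, m.2 + 1))) =
    (bd d x m).2 - (-1) ^ d *:
      (m.2%:~R *: ((x (m.1 + 1, m.2)).1 - sing_bd (y0 (m.1 + 1, m.2))) -
       m.1%:~R *: ((x (m.1, m.2 + 1)).1 - sing_bd (y0 (m.1, m.2 + 1)))).
    rewrite /bd mI /= sing_bdD sing_bdZ sing_bdB !sing_bdZ -addrA -scalerBr.
    congr (_ + _ *: _); rewrite !scalerBr.
    exact: subr_subr_cancel.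
  apply: chains_inB.
    by have [_] := bC m mI; congr (chains_in _ _ _); lia.
  apply: chains_inZ; apply: chains_inB; apply: chains_inZ.
    by move: y1V => /(chains_inS _ _ _ _ V1); congr (chains_in _ _ _); lia.
  by move: y2V => /(chains_inS _ _ _ _ V2); congr (chains_in _ _ _); lia.
have /choice[y1 y1P] : forall m, exists b, ((x' m).2 = 0 -> b = 0) /\
   (index_set m -> chains_in U (d - 2 * (m.1 + m.2) + 1) b /\
      chains_in (sublevel Omega e%:E m) (d - 2 * (m.1 + m.2)) ((x' m).2 - sing_bd b)).
  move=> m; have [xm|xm] := pselect ((x' m).2 = 0).
    exists 0; split => // _; rewrite xm sing_bd0 subr0.
    by split; exact: chains_in0.
  have mI : index_set m.
    apply: contrapT => /negP mI; apply: xm; rewrite /x' chain_familyD chain_familyN.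
    by rewrite xI// /bd (negbTE mI) /= subr0.
  have [xU xV] := x'2 m mI.
  have [] := fill_chain e m (d - 2 * (m.1 + m.2)) (x' m).2 e0 ec mI xU xV.
    by move=> _ _ d0; case: (dodd (m.1 + m.2)); lia.
  by move=> b ? ?; exists b; split => // /xm.
exists (fun m => (y0 m, y1 m)).
  split.
  - have : finite_set ([set m | x m <> 0] `|` [set m | x' m <> 0]).
      by rewrite finite_setU.
    apply: sub_finite_set => m /= ym.
    have [xm|] := pselect (x m = 0); last by left.
    right => x'm; apply: ym.
    by rewrite (proj1 (y0P m))// (proj1 (y1P m))// x'm.
  - move=> m mI; rewrite (proj1 (y0P m)) ?xI// (proj1 (y1P m))//.
    rewrite /x' chain_familyD chain_familyN.
    by rewrite xI// /bd (negbTE mI) /= subr0.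
  - move=> m mI; rewrite sublevel_oo /=.
    have [_ /(_ mI)[y0U _]] := y0P m; have [_ /(_ mI)[y1U _]] := y1P m; split.
      by move: y0U; congr (chains_in _ _ _); lia.
    by move: y1U; congr (chains_in _ _ _); lia.
have zE m : index_set m -> (x - bd (d + 1) (fun m => (y0 m, y1 m))) m =
    ((x m).1 - sing_bd (y0 m), (x' m).2 - sing_bd (y1 m)).
  move=> mI; rewrite /x' !chain_familyD !chain_familyN /bd mI /=.
  by congr pair; rewrite sing_bd0 add0r opprD addrAC addrA.
split.
- have : finite_set ([set m | x m <> 0] `|` [set m | x' m <> 0]).
    by rewrite finite_setU.
  apply: sub_finite_set => m /= zm.
  have [xm|] := pselect (x m = 0); last by left.
  right => x'm; apply: zm.
  have [mI|mI] := boolP (index_set m).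
    rewrite zE// (proj1 (y0P m))// (proj1 (y1P m)) ?x'm//= xm.
    by rewrite sing_bd0 subrr.
  by rewrite chain_familyD chain_familyN /bd (negbTE mI) xm /= subr0.
- move=> m mI.
  by rewrite chain_familyD chain_familyN /bd (negbTE mI) xI /= ?subr0.
- move=> m mI; rewrite zE//=.
  by have [_ /(_ mI)[_ ?]] := y0P m; have [_ /(_ mI)[_ ?]] := y1P m.
Qed.
End Vanishing.

(** * Intermediate values on the 1-simplex *)

Section Interval.
Context {R : realType}.

(** Clamping extends the parametrisation of the 1-simplex to a continuous map on the whole line, as
    the intermediate value theorem is applied there. *)
Definition clamp (s : R) : R := Num.max 0 (Num.min s 1).

Lemma clamp_itv s : 0 <= clamp s <= 1.
Proof. by rewrite /clamp le_max lexx/= ge_max ler01 ge_min lexx orbT. Qed.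

Lemma clampK s : 0 <= s <= 1 -> clamp s = s.
Proof. by move=> /andP[s0 s1]; rewrite /clamp min_l// max_r. Qed.

Definition segv (s : R) : 'rV[R]_2 :=
  \row_j (if j == ord0 then 1 - clamp s else clamp s).

Lemma segv_in s : segv s \in std_simplex R 1.
Proof.
have /andP[c0 c1] := clamp_itv s.
apply/mem_set; split; last by rewrite big_ord_recl big_ord1 !mxE /= subrK.
by move=> j; rewrite mxE; case: ifP => _ //; rewrite subr_ge0.
Qed.

Definition seg (s : R) : std_simplex R 1 := exist _ (segv s) (segv_in s).

Lemma clamp_lip s u : `|clamp s - clamp u| <= `|s - u|.
Proof.
rewrite ler_norml /clamp.
have := normr_ge0 (s - u); have := ler_norm (s - u); have : - (s - u) <= `|s - u| by rewrite -normrN ler_norm.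
case: (leP 0 (Num.min s 1)); case: (leP 0 (Num.min u 1));
  case: (leP s 1) => ?; case: (leP u 1) => ? ? ? ? ? ?; apply/andP; split; lra.
Qed.

Lemma continuous_clamp : continuous clamp.
Proof.
move=> s; apply/cvg_ballP => e e0; near=> u.
rewrite /ball/=; apply: le_lt_trans (clamp_lip _ _) _.
by near: u; exact: (nbhsx_ballx s e e0).
Unshelve. all: by end_near. Qed.

Lemma continuous_seg : continuous seg.
Proof.
apply: (@continuous_comp_initial _ _ _ set_val) => s.
have FF : Filter (nbhs s) by exact: nbhs_filter.
change ((segv u @[u --> s]) --> segv s).
apply/cvg_ballP => e e0.
have /cvg_ballP/(_ e e0) := @continuous_clamp s.
apply: filterS => u su; split=> // k j; rewrite !mxE; case: ifP => _ //.
rewrite /ball/= (_ : 1 - _ - _ = - (clamp s - clamp u)) ?normrN//.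
by ring.
Qed.

Lemma segE (t : std_simplex R 1) : t = seg (bary t ord_max).
Proof.
apply: eq_set_val; apply/rowP => j; rewrite mxE clampK ?simplex_le1//.
have /set_mem[_] := valP t; rewrite big_ord_recl big_ord1 => <-.
rewrite (_ : fintype.lift _ _ = ord_max); last exact: val_inj.
case: ifP => [/eqP ->|j0]; first by rewrite addrK.
by congr (_ _ _); apply: val_inj; case: j j0 => -[|[|]].
Qed.

Lemma same_sign (h : std_simplex R 1 -> R) : continuous h ->
  (forall t, h t <> 0) -> forall t u, 0 < h t -> 0 < h u.
Proof.
move=> ch h0 t u ht; rewrite ltNge; apply/negP => hu.
have chs : continuous (h \o seg).
  by move=> s; apply: continuous_comp; [exact: continuous_seg|exact: ch].
have [s _ /h0//] : exists2 s, s \in `[Num.min (bary t ord_max) (bary u ord_max),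
    Num.max (bary t ord_max) (bary u ord_max)]%R & h (seg s) = 0.
have [tu|ut] := leP (bary t ord_max) (bary u ord_max).
  apply: (@IVT _ (h \o seg)) => //; first exact: continuous_subspaceT.
  by rewrite /= -!segE ge_min le_max hu (ltW ht) orbT.
apply: (@IVT _ (h \o seg)) => //; [exact: ltW|exact: continuous_subspaceT|].
by rewrite /= -!segE ge_min le_max hu (ltW ht) orbT.
Qed.

End Interval.

(** * Counting the points of a 0-chain on one side *)

Section Counting.
Context {R : realType}.
Implicit Types (f : R * R -> R) (V : set (R * R)) (c : sing_chain R).

Definition count_pos f (c : sing_chain R) : rat :=
  weight (fun y => (0 < f y)%R%:R) c.

(** Along a path in V the function f keeps its sign, so the two ends cancel in the count. *)
Lemma count_pos_bd f V n c : continuous f -> (forall y, V y -> f y <> 0) ->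
  chains_in V n c -> count_pos f (sing_bd c) = 0.
Proof.
move=> cf f0 cV; apply: weight_bd => s sc t u; have [_ sV] := cV _ sc.
have ch : continuous (f \o s).
  by move=> x; apply: continuous_comp; [exact: cts_fun|exact: cf].
have h0 x : (f \o s) x <> 0 by apply: f0; apply: sV; exists x.
suff -> : (0 < f (s t)) = (0 < f (s u)) by [].
by apply/idP/idP; exact: same_sign ch h0 _ _.
Qed.

Lemma count_posB f : {morph count_pos f : c d / c - d}.
Proof. by move=> c d; rewrite /count_pos /weight fgliftB. Qed.

Lemma count_posZ f q c : count_pos f (q *: c) = q * count_pos f c.
Proof. by rewrite /count_pos /weight fgliftZ. Qed.

Lemma count_pos_add V n f c : (forall y, V y -> f y <> 0) -> chains_in V n c ->
  weight (cst 1) c = count_pos f c + count_pos (fun y => - f y) c.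
Proof.
move=> f0 cV; rewrite /count_pos.
rewrite (@eq_weight _ V n _ (fun y => (0 < f y)%R%:R + (0 < - f y)%R%:R) c cV).
  rewrite /weight !fgliftE -big_split /=; apply: eq_bigr => -[[|m] s] _.
    exact: mulrDr.
  by rewrite scaler0 addr0.
move=> y /set_mem/f0/eqP; rewrite oppr_gt0.
by case: ltgtP => // _ _; rewrite ?addr0 ?add0r.
Qed.

Lemma eq_count_pos V n f f' c : chains_in V n c ->
  (forall y, V y -> (0 < f y) = (0 < f' y)) -> count_pos f c = count_pos f' c.
Proof. by move=> cV ff'; apply: (eq_weight V n _ _ c cV) => y /set_mem/ff' ->. Qed.

Lemma count_pos0 V n f c : chains_in V n c -> (forall y, V y -> f y <= 0) ->
  count_pos f c = 0.
Proof.
move=> cV f0; rewrite (@eq_count_pos V n f (fun=> 0) c cV).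
  rewrite /count_pos /weight fgliftE big1// => -[[|m] s] _; rewrite ?ltxx;
    exact: scaler0.
by move=> y Vy; rewrite ltxx ltNge f0.
Qed.

End Counting.

(** * Lower bound: the 0-chains of a relative cycle have weight zero *)

Section Lower.
Context {R : realType} {g : R -> R} {Omega : set (R * R)}.
Hypothesis gOmega : polar g Omega.
Hypothesis Omega_convex : weakly_convex Omega.
Variables (k : nat) (a : R) (p : nat -> R * R).
Hypothesis k_gt0 : (0 < k)%N.
Hypothesis a_gt0 : 0 < a.
Hypothesis Omega_p : forall j, (j <= k)%N -> Omega (p j).
Hypothesis a_le : forall j, (j <= k)%N -> a <= A_form j (k - j)%N (p j).

Lemma continuous_cross (q : R * R) : continuous (cross q).
Proof.
move=> y; have FF : Filter (nbhs y) by exact: nbhs_filter.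
apply: (@cvgB _ _ _ _ FF); apply: (@cvgM _ _ _ FF); try exact: cvg_cst.
  exact: cvg_snd.
exact: cvg_fst.
Qed.

Lemma continuous_Ncross (q : R * R) : continuous (fun y => - cross q y).
Proof.
move=> y; have FF : Filter (nbhs y) by exact: nbhs_filter.
by apply: (@cvgN _ _ _ _ FF); exact: continuous_cross.
Qed.

(** A point y on the ray of p_j with a smaller value of the form is a multiple of p_j by a factor in
    [0, 1], hence lies in Omega. *)
Lemma cross_neq0 j y : (j <= k)%N -> sublevel Omega a%:E (j : int, (k - j)%N : int) y ->
  cross (p j) y <> 0.
Proof.
move=> jk [[y1 y2 Oy]]; rewrite lte_fin /= => Ay.
have [p1 p2] := Omega_ge0 gOmega _ (Omega_p _ jk); have ap := a_le _ jk.
have Oq : forall t, Omega (t * (p j).1, t * (p j).2) -> y <> (t * (p j).1, t * (p j).2).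
  by move=> t Ot yt; apply: Oy; rewrite yt.
move: ap Ay; set A := A_form j _ => ap Ay c0.
have j0 : 0 <= j%:R :> R by []. have l0 : 0 <= (k - j)%:R :> R by [].
have Ap : 0 < A (p j) by exact: lt_le_trans ap.
have Ay0 : 0 <= A y.
  by rewrite /A /A_form -!pmulrn addr_ge0// mulr_ge0// ltW.
apply: (Oq (A y / A (p j))).
  apply: (Omega_star gOmega); first exact: Omega_p.
  by rewrite divr_ge0 ?(ltW Ap)//= ler_pdivrMr// mul1r ltW// (lt_le_trans Ay).
have E1 : A (p j) * y.1 = A y * (p j).1.
  transitivity (A y * (p j).1 - (k - j)%:R * cross (p j) y); last by rewrite c0 mulr0 subr0.
  by rewrite /A /A_form /cross -!pmulrn; ring.
have E2 : A (p j) * y.2 = A y * (p j).2.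
  transitivity (A y * (p j).2 + j%:R * cross (p j) y); last by rewrite c0 mulr0 addr0.
  by rewrite /A /A_form /cross -!pmulrn; ring.
case: y {y1 y2 Oy Ay c0 Ay0 Oq} E1 E2 => u v /= E1 E2.
by congr pair; apply: (mulfI (lt0r_neq0 Ap)); [rewrite E1|rewrite E2]; field;
  rewrite lt0r_neq0.
Qed.

Lemma A_form_mono (m1 m2 n1 n2 : int) (y : R * R) : 0 <= y.1 -> 0 <= y.2 ->
  m1 <= n1 -> m2 <= n2 -> A_form m1 m2 y <= A_form n1 n2 y.
Proof. by move=> y1 y2 mn1 mn2; apply: lerD; rewrite ler_wpM2r ?ler_int. Qed.

(** If the rays disagreed, y would lie in the sector between p_j and p_{j+1}. Both points have
    A_{j+1,k-j} >= a, and [sector_le] would give the same for y. *)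
Lemma cross_consistent j y : (j < k)%N ->
  sublevel Omega a%:E (j.+1 : int, (k - j)%N : int) y ->
  (0 < cross (p j) y) = (0 < cross (p j.+1) y).
Proof.
move=> jk Vy; have [[y1 y2 Oy]] := Vy; rewrite lte_fin => Ay.
have n1 : cross (p j) y != 0.
  apply/eqP; apply: (cross_neq0 j y (ltnW jk)).
  by apply: sublevelS Vy => //=; lia.
have n2 : cross (p j.+1) y != 0.
  apply/eqP; apply: (cross_neq0 j.+1 y jk).
  by apply: sublevelS Vy => //=; lia.
have [p1 p2] := Omega_ge0 gOmega _ (Omega_p _ (ltnW jk)).
have [q1 q2] := Omega_ge0 gOmega _ (Omega_p _ jk).
have ap : a <= A_form j.+1 (k - j)%N (p j).
  by apply: le_trans (a_le j (ltnW jk)) _; apply: A_form_mono => //; lia.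
have aq : a <= A_form j.+1 (k - j)%N (p j.+1).
  by apply: le_trans (a_le j.+1 jk) _; apply: A_form_mono => //; lia.
have NC u : cross y u = - cross u y by rewrite /cross; ring.
have absurd w q : Omega w -> Omega q -> a <= A_form j.+1 (k - j)%N w ->
    a <= A_form j.+1 (k - j)%N q -> 0 < cross w y -> 0 < cross q y.
  move=> Ow Oq aw aq' wy; rewrite ltNge; apply/negP => qy.
  have : a <= A_form j.+1 (k - j)%N y; last by rewrite leNgt Ay.
  have yq : 0 <= cross y q by rewrite NC oppr_ge0.
  apply: (sector_le gOmega Omega_convex _ _ w q) => //; try lra.
  by move=> t; exact: (notin_scale gOmega).
have Op := Omega_p _ (ltnW jk); have Oq := Omega_p _ jk.
by apply/idP/idP; apply: absurd.
Qed.

Lemma cross_consistentN j y : (j < k)%N ->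
  sublevel Omega a%:E (j.+1 : int, (k - j)%N : int) y ->
  (0 < - cross (p j) y) = (0 < - cross (p j.+1) y).
Proof.
move=> jk Vy; rewrite !oppr_gt0.
have /eqP n1 : cross (p j) y <> 0.
  by apply: (cross_neq0 j y (ltnW jk)); apply: sublevelS Vy => //=; lia.
have /eqP n2 : cross (p j.+1) y <> 0.
  by apply: (cross_neq0 j.+1 y jk); apply: sublevelS Vy => //=; lia.
by rewrite !lt_neqAle n1 n2 /= !leNgt (cross_consistent j y jk Vy).
Qed.

Variables (e : R) (x : chain_family R).
Hypothesis e_gt0 : 0 < e.
Hypothesis e_le : e <= corner g.
(** With the next hypothesis, the smallness of e that keeps the thin sublevel sets along the two
    axes on one side of the rays of p_0 and p_k ([thin0], [think]). *)
Hypothesis e_p0 : e * ((p 0).1 + (p 0).2) <= corner g * (p 0).2.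
Hypothesis e_pk : e * ((p k).1 + (p k).2) <= corner g * (p k).1.

Let d : int := (2 * k + 1)%N.
Hypothesis xP : rel_cycles Omega e%:E a%:E d x.

Let X (q : nat) : sing_chain R := (x (q : int, (k.+1 - q)%N : int)).1.

Let X_in q : (0 < q <= k)%N ->
  chains_in (sublevel Omega a%:E (q : int, (k.+1 - q)%N : int)) 0 (X q).
Proof.
move=> /andP[q0 qk]; have [[_ _ xC] _] := xP.
have mI : index_set (q : int, (k.+1 - q)%N : int).
  by rewrite /index_set /=; lia.
by have [+ _] := xC _ mI; congr (chains_in _ _ _); rewrite /d /=; lia.
Qed.

(** The e_1 component at (j, k - j) of the cycle equation: up to a chain in the sublevel set of e,
    where nothing is counted, (k - j) X_{j+1} - j X_j is the boundary of a 1-chain that avoids the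
    zeros of f. *)
Let count_rel j (f : R * R -> R) : (j <= k)%N -> continuous f ->
  (forall y, sublevel Omega a%:E (j : int, (k - j)%N : int) y -> f y <> 0) ->
  (forall y, sublevel Omega e%:E (j : int, (k - j)%N : int) y -> f y <= 0) ->
  (k - j)%:R * count_pos f (X j.+1) = j%:R * count_pos f (X j).
Proof.
move=> jk cf f0 fe; have [[_ _ xC] [_ _ bC]] := xP.
set m := (j : int, (k - j)%N : int) in f0 fe *.
have mI : index_set m by rewrite /index_set /=; lia.
have [_] := bC m mI; rewrite /bd mI /=.
have -> : (x (j%:Z + 1, (k - j)%N : int)).1 = X j.+1.
  by rewrite /X; congr (x (_, _)).1; lia.
have -> : (x (j%:Z, (k - j)%N%:Z + 1)).1 = X j.
  by rewrite /X; congr (x (_, _)).1; lia.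
move=> /(count_pos0 _ _ _ _)/(_ fe).
have -> : (-1) ^ d = -1 :> rat.
  by rewrite /d -exprnP addn1 exprS mulnC exprM sqrr_sign mulr1.
rewrite scaleN1r count_posB (count_pos_bd _ _ _ _ cf f0 (proj2 (xC m mI))).
rewrite sub0r count_posB !count_posZ -!pmulrn => /eqP.
by rewrite oppr_eq0 subr_eq0 => /eqP.
Qed.

Let thin0 y : sublevel Omega e%:E (0 : int, k : int) y -> cross (p 0) y <= 0.
Proof.
move=> [[y1 y2 Oy]]; rewrite lte_fin /A_form /= mul0r add0r -pmulrn => ky.
have [p1 p2] := Omega_ge0 gOmega _ (Omega_p 0 isT).
have k1 : 1 <= k%:R :> R by rewrite ler1n.
have ye : y.2 < e by nra.
have := a_le 0 isT; rewrite /A_form /= mul0r add0r subn0 -pmulrn => ap.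
have p2' : 0 < (p 0).2.
  rewrite lt_neqAle p2 andbT; apply/eqP => z.
  by move: (lt_le_trans a_gt0 ap); rewrite -z mulr0 ltxx.
rewrite leNgt; apply/negP; rewrite /cross => c0; apply: Oy.
apply: (triangle_in gOmega Omega_convex); [exact: ltW..|].
rewrite -(ler_pM2r p2') (le_trans _ e_p0)//; nra.
Qed.

Let think y : sublevel Omega e%:E (k : int, 0 : int) y -> - cross (p k) y <= 0.
Proof.
move=> [[y1 y2 Oy]]; rewrite lte_fin /A_form /= mul0r addr0 -pmulrn => ky.
have [p1 p2] := Omega_ge0 gOmega _ (Omega_p k (leqnn k)).
have k1 : 1 <= k%:R :> R by rewrite ler1n.
have ye : y.1 < e by nra.
have := a_le k (leqnn k); rewrite /A_form /= subnn mul0r addr0 -pmulrn => ap.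
have p1' : 0 < (p k).1.
  rewrite lt_neqAle p1 andbT; apply/eqP => z.
  by move: (lt_le_trans a_gt0 ap); rewrite -z mulr0 ltxx.
rewrite leNgt; apply/negP; rewrite /cross => c0; apply: Oy.
apply: (triangle_in gOmega Omega_convex); [exact: ltW..|].
rewrite -(ler_pM2r p1') (le_trans _ e_pk)//; nra.
Qed.

Let sub0 j y : (0 < j < k)%N -> ~ sublevel Omega e%:E (j : int, (k - j)%N : int) y.
Proof.
move=> /andP[j0 jk]; rewrite (sublevel_empty gOmega Omega_convex) //=; lia.
Qed.

(** Descending induction. At j = k the factor k - j vanishes; afterwards [cross_consistentN] passes
    from p_{j+1} to p_j on X_{j+1}, and [count_rel] passes from X_{j+1} to X_j. *)
Let right0 q : (0 < q <= k)%N -> count_pos (fun y => - cross (p q) y) (X q) = 0.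
Proof.
have rel j : (0 < j <= k)%N ->
    (k - j)%:R * count_pos (fun y => - cross (p j) y) (X j.+1) =
    j%:R * count_pos (fun y => - cross (p j) y) (X j).
  move=> /andP[j0 jk]; apply: count_rel => //; first exact: continuous_Ncross.
    by move=> y Vy /eqP; rewrite oppr_eq0 => /eqP; exact: cross_neq0.
  move=> y Vy; have [jk'|kj] := ltnP j k; first by case: (sub0 j y _ Vy); rewrite j0.
  by have jE : j = k by [lia]; move: Vy; rewrite jE subnn; exact: think.
have step i : (i < k)%N ->
    count_pos (fun y => - cross (p (k - i)) y) (X (k - i)) = 0.
  elim: i => [|i IH] ik.
    have := rel k; rewrite k_gt0 leqnn subnn mul0r subn0 => /(_ isT)/esym/eqP.
    by rewrite mulf_eq0 pnatr_eq0 (negbTE (lt0n_neq0 k_gt0)) => /eqP.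
  have q0 : (0 < k - i.+1 <= k)%N by lia.
  have := rel (k - i.+1)%N q0.
  have -> : ((k - i.+1).+1 = k - i)%N by lia.
  have q1 : (0 < k - i <= k)%N by lia.
  rewrite (eq_count_pos _ _ _ (fun y => - cross (p (k - i)) y) _ (X_in _ q1)); last first.
    move=> y Vy; have jk : (k - i.+1 < k)%N by lia.
    have := cross_consistentN (k - i.+1) y jk.
    rewrite (_ : (k - i.+1).+1 = k - i)%N; last by lia.
    rewrite (_ : k - (k - i.+1) = k.+1 - (k - i))%N; last by lia.
    exact.
  rewrite IH ?mulr0; last by lia.
  move=> /esym/eqP; rewrite mulf_eq0 pnatr_eq0.
  by have -> : (k - i.+1 == 0)%N = false by [lia]; move=> /eqP.
move=> q0; have -> : q = (k - (k - q))%N by lia.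
by apply: step; lia.
Qed.

(** Ascending induction, started by the vanishing of the factor j at j = 0. *)
Let left0 q : (q < k)%N -> count_pos (cross (p q)) (X q.+1) = 0.
Proof.
have rel j : (j < k)%N ->
    (k - j)%:R * count_pos (cross (p j)) (X j.+1) =
    j%:R * count_pos (cross (p j)) (X j).
  move=> jk; apply: count_rel; [exact: ltnW|exact: continuous_cross| |].
    by move=> y; apply: cross_neq0; exact: ltnW.
  move=> y Vy; have [j0|j0] := posnP j; last by case: (sub0 j y _ Vy); rewrite j0.
  by move: Vy; rewrite j0 subn0; exact: thin0.
elim: q => [|q IH] qk; have := rel _ qk.
  move=> /eqP; rewrite mul0r mulf_eq0 pnatr_eq0 subn0.
  by rewrite (negbTE (lt0n_neq0 k_gt0)) => /eqP.
have q1 : (0 < q.+1 <= k)%N by lia.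
rewrite [X in _ = _ * X](eq_count_pos _ _ _ (cross (p q)) _ (X_in _ q1)); last first.
  by move=> y Vy; rewrite (cross_consistent q)//; exact: ltnW.
rewrite IH ?mulr0; last exact: ltnW.
move=> /eqP; rewrite mulf_eq0 pnatr_eq0.
by have -> : (k - q.+1 == 0)%N = false by [lia]; move=> /eqP.
Qed.

Lemma weight_antidiagonal m : 0 < m.1 -> 0 < m.2 -> m.1 + m.2 = k.+1%:Z ->
  weight (cst 1) (x m).1 = 0.
Proof.
case: m => -[q|//] m2 /= q0 m20 mk; have qk : (0 < q <= k)%N by lia.
have -> : m2 = (k.+1 - q)%N :> int by lia.
have cV : chains_in (sublevel Omega a%:E (q : int, (k - q)%N : int)) 0 (X q).
  apply: chains_inS (X_in _ qk); apply: sublevelS => //=; lia.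
rewrite -/(X q) (count_pos_add _ _ (cross (p q)) _ _ cV); last first.
  by move=> y; apply: cross_neq0; case/andP: qk.
rewrite right0// addr0; case: q {q0 mk cV} qk => // q qk.
have qk' : (q < k)%N by [].
rewrite (eq_count_pos _ _ _ (cross (p q)) _ (X_in _ qk)) ?left0//.
by move=> y Vy; rewrite (cross_consistent q).
Qed.

End Lower.

(** * Vanishing of the natural map *)

Section NaturalMapZero.
Context {R : realType} {g : R -> R} {Omega : set (R * R)}.
Hypothesis gOmega : polar g Omega.
Hypothesis Omega_convex : weakly_convex Omega.

(** An element of the inverse limit is determined at delta by its component at any smaller e. For e
    small enough, that component has a representative which bounds at level infinity. *)
Lemma natural_map_zero (k : nat) (a : R) : (0 < k)%N -> 0 < a ->
  (forall j, (j <= k)%N -> exists2 p, Omega p & a <= A_form j (k - j)%N p) ->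
  ~ natural_map_nonzero Omega a (2 * k + 1)%:Z.
Proof.
move=> k0 a0 Mp.
have dodd (i : int) : (2 * k + 1)%:Z <> 2 * i by lia.
have dimE (m : int * int) : (2 * k + 1)%:Z + 1 - 2 * (m.1 + m.2) = 0 ->
    m.1 + m.2 = k.+1%:Z by lia.
move=> [h [hh hc] [delta [d0]]]; apply; rewrite /natural_map.
have /choice[p pP] : forall j, exists p, (j <= k)%N ->
    Omega p /\ a <= A_form j (k - j)%N p.
  move=> j; have [jk|jk] := leqP j k; last by exists 0.
  by have [p ? ?] := Mp j jk; exists p.
have Op j (jk : (j <= k)%N) := proj1 (pP j jk).
have Ap j (jk : (j <= k)%N) := proj2 (pP j jk).
have c0 := corner_gt0 gOmega.
(* This gives the thresholds for e: the second coordinate of p_0 and the first of p_k are positive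
   because their forms are at least a > 0. *)
have small (S T : R) : 0 < T -> T <= S -> exists2 e0 : R, 0 < e0 &
    forall e, e <= e0 -> e * S <= corner g * T.
  move=> T0 TS; have S0 := lt_le_trans T0 TS.
  exists (corner g * T / S); first by rewrite divr_gt0 ?mulr_gt0.
  by move=> e; rewrite ler_pdivlMr.
have [p01 p02] := Omega_ge0 gOmega _ (Op 0 isT).
have [pk1 pk2] := Omega_ge0 gOmega _ (Op k (leqnn k)).
have [e1 e10 e1P] : exists2 e0 : R, 0 < e0 & forall e, e <= e0 ->
    e * ((p 0).1 + (p 0).2) <= corner g * (p 0).2.
  apply: small; last by rewrite lerDr.
  have := Ap 0 isT; rewrite /A_form /= mul0r add0r subn0 -pmulrn => ap.
  rewrite lt_neqAle p02 andbT; apply/eqP => z.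
  by move: (lt_le_trans a0 ap); rewrite -z mulr0 ltxx.
have [e2 e20 e2P] : exists2 e0 : R, 0 < e0 & forall e, e <= e0 ->
    e * ((p k).1 + (p k).2) <= corner g * (p k).1.
  apply: small; last by rewrite lerDl.
  have := Ap k (leqnn k); rewrite /A_form /= subnn mul0r addr0 -pmulrn => ap.
  rewrite lt_neqAle pk1 andbT; apply/eqP => z.
  by move: (lt_le_trans a0 ap); rewrite -z mulr0 ltxx.
pose t := Num.min delta (a / 2).
have t0 : 0 < t by rewrite lt_min d0 divr_gt0.
have ta : t < a by rewrite /t gt_min ltr_pdivrMr// ltr_pMr// ltr1n orbT.
have td : t <= delta by rewrite /t ge_min lexx.
pose e := Num.min (Num.min t (corner g)) (Num.min e1 e2).
have e0 : 0 < e by rewrite 2!lt_min t0 c0 lt_min e10 e20.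
have et : e <= t by rewrite /e ge_min ge_min lexx.
have ec : e <= corner g by rewrite /e ge_min ge_min lexx orbT.
have ee1 : e <= e1 by rewrite /e ge_min; apply/orP; right; rewrite ge_min lexx.
have ee2 : e <= e2 by rewrite /e ge_min; apply/orP; right; rewrite ge_min lexx orbT.
have [x0 x0P x0E] := hh e e0 (le_lt_trans et ta).
have x0B : rel_boundaries Omega e%:E +oo%E (2 * k + 1)%:Z x0.
  have [x0D x0C] := x0P.
  apply: (cycle_is_boundary gOmega Omega_convex e _ x0 e0 ec dodd) => //.
  - by apply: domainS x0D; rewrite leey.
  - move=> m m1 m2 mk.
    have mk' := dimE m mk.
    exact: (weight_antidiagonal gOmega Omega_convex k a p k0 a0 Op Ap e x0 e0 ec
      (e1P e ee1) (e2P e ee2) x0P m m1 m2 mk').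
rewrite -/t -(hc e t e0 et ta) -x0E.
rewrite (hmap_hclass _ _ _ _ _ _ x0)//.
rewrite (hmap_hclass _ _ _ _ _ _ x0) ?leey ?lee_fin//.
apply: hclass_eq; rewrite subr0.
by apply: rel_boundariesS x0B; rewrite ?lee_fin// (le_trans et).
Qed.

End NaturalMapZero.

(** * Singular simplices on a parametrised curve *)

Section Curve.
Context {R : realType} {Gam : R -> R * R}.
Hypothesis cGam : continuous Gam.

Definition affine {n} (l : nat -> R) (t : std_simplex R n) : R :=
  \sum_(i < n.+1) bary t i * l i.

Lemma continuous_affine n (l : nat -> R) : continuous (@affine n l).
Proof.
move=> t; have FF : Filter (nbhs t) by exact: nbhs_filter.
apply: (@cvg_big _ _ _ _ _ _ _ _ _ _ _ FF) => [|j _]; first exact: add_continuous.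
by apply: (@cvgM _ _ _ FF); [exact: continuous_bary|exact: cvg_cst].
Qed.

Lemma affine_itv n (l : nat -> R) (t : std_simplex R n) (u v : R) :
  (forall i, (i <= n)%N -> u <= l i <= v) -> u <= affine l t <= v.
Proof.
move=> luv; have /set_mem[t0 t1] := valP t.
have {}t1 : \sum_(i < n.+1) bary t i = 1 := t1.
apply/andP; split.
  rewrite -[u]mul1r -t1 mulr_suml; apply: ler_sum => i _; apply: ler_wpM2l; first exact: t0.
  by have /andP[] := luv i (ltn_ord i).
rewrite -[v]mul1r -t1 mulr_suml; apply: ler_sum => i _; apply: ler_wpM2l; first exact: t0.
by have /andP[] := luv i (ltn_ord i).
Qed.

Lemma affine_face n (l : nat -> R) (i : 'I_n.+2) (t : std_simplex R n) :
  affine l (face i t) = affine (fun j => l (bump i j)) t.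
Proof.
rewrite /affine (bigD1 i)//= {1}/bary set_val_face mxE unlift_none mul0r add0r.
rewrite (reindex_onto (fintype.lift i) (fun j => odflt ord0 (unlift i j)))/=; last first.
  by move=> j; case: unliftP => [j' ->//|->]; rewrite eqxx.
apply: eq_big => [j|j _]; first by rewrite liftK !eqxx andbT eq_sym neq_lift.
by rewrite /bary set_val_face mxE liftK.
Qed.

Lemma continuous_curve n (l : nat -> R) : continuous (fun t : std_simplex R n => Gam (affine l t)).
Proof.
by move=> t; apply: continuous_comp; [exact: continuous_affine|exact: cGam].
Qed.

(** The simplex is mapped affinely to the parameter line, with values l at the vertices, and then to
    the curve; faces are again of this kind, so boundaries are computed on the lists of
    parameters. *)
Definition curve n (l : nat -> R) : sing_simplex R :=
  existT _ n (mkcts (continuous_curve n l) : continuousType (std_simplex R n) _).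

Lemma curve_face n l (i : 'I_n.+2) :
  sing_face (mkcts (continuous_curve n.+1 l) : continuousType (std_simplex R n.+1) _) i =
  curve n (fun j => l (bump i j)).
Proof. by apply: sing_simplexP => t; rewrite /= /mkcts affine_face. Qed.

Lemma eq_curve n l l' : (forall i, (i <= n)%N -> l i = l' i) -> curve n l = curve n l'.
Proof.
move=> ll'; apply: sing_simplexP => t; rewrite /= /mkcts; congr (Gam _).
by apply: eq_bigr => i _; rewrite ll'// -ltnS.
Qed.

Lemma curve_in n l u v (V : set (R * R)) : (forall i, (i <= n)%N -> u <= l i <= v) ->
  (forall w, u <= w <= v -> V (Gam w)) -> chains_in V n << curve n l >>.
Proof.
move=> luv wV; apply: chains_inU => //= _ [t _ <-]; rewrite /= /mkcts.
by apply: wV; exact: affine_itv.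
Qed.

Definition curve_point (u : R) : sing_chain R := << curve 0 (fun=> u) >>.
Definition curve_path (u v : R) : sing_chain R := << curve 1 (nth 0 [:: u; v]) >>.
Definition curve_triangle (u v w : R) : sing_chain R :=
  << curve 2 (nth 0 [:: u; v; w]) >>.

Lemma bd_curve_point u : sing_bd (curve_point u) = 0.
Proof. exact: fgliftU. Qed.

Lemma bd_curve_path u v : sing_bd (curve_path u v) = curve_point v - curve_point u.
Proof.
rewrite /sing_bd fgliftU /= big_ord_recl big_ord1 expr0 expr1 scale1r scaleN1r.
rewrite !curve_face; congr (<< _ >> - << _ >>); by apply: eq_curve => -[].
Qed.

Lemma bd_curve_triangle u v w :
  sing_bd (curve_triangle u v w) = curve_path v w - curve_path u w + curve_path u v.
Proof.
rewrite /sing_bd fgliftU /= 2!big_ord_recl big_ord1 /= expr0 expr1 expr2 mulN1r opprK.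
rewrite !scale1r scaleN1r addrA !curve_face.
by congr (<< _ >> - << _ >> + << _ >>); apply: eq_curve => -[|[]].
Qed.

Lemma curve_point_in V u : V (Gam u) -> chains_in V 0 (curve_point u).
Proof.
move=> Vu; apply: (@curve_in 0 _ u u) => [i _|w]; first by rewrite lexx.
by rewrite -eq_le => /eqP <-.
Qed.

Lemma curve_path_in V u v : (forall w, Num.min u v <= w <= Num.max u v -> V (Gam w)) ->
  chains_in V 1 (curve_path u v).
Proof.
move=> Vu; apply: (curve_in _ _ _ _ _ _ Vu) => -[|[|]]//= _;
  by rewrite ge_min le_max lexx ?orbT.
Qed.

Lemma curve_triangle_in V a b u v w :
  a <= u <= b -> a <= v <= b -> a <= w <= b ->
  (forall w, a <= w <= b -> V (Gam w)) -> chains_in V 2 (curve_triangle u v w).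
Proof. by move=> ? ? ? Vu; apply: (curve_in _ _ _ _ _ _ Vu) => -[|[|[|]]]. Qed.

Lemma weight_curve_point w u : weight w (curve_point u) = w (Gam u).
Proof.
rewrite /weight fgliftU /= /mkcts; congr (w (Gam _)).
have /andP[le1 le2] := affine_itv 0 (fun=> u) (vertex 0) u u (fun _ _ => introT andP (conj (lexx u) (lexx u))).
by apply/eqP; rewrite eq_le le1 le2.
Qed.

End Curve.

Lemma addrB_cancel (V : zmodType) (p q t : V) : p - q + (q - p + t) = t.
Proof. by rewrite addrA -(opprB p q) subrr add0r. Qed.

Lemma subrB_cancel (V : zmodType) (p q t : V) : p - q - (t - q + p) = - t.
Proof. by rewrite [t - q + p]addrAC -[t + p - q]addrA opprD addrCA subrr addr0. Qed.

(** * Indices and degrees on the antidiagonals *)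

Definition diag (b n : nat) (m : int * int) : bool :=
  [&& b%:Z <= m.1, b%:Z <= m.2 & m.1 + m.2 == n%:Z].

Definition in_triangle (n : nat) (m : int * int) : bool :=
  [&& 0 <= m.1, 0 <= m.2 & m.1 + m.2 <= n%:Z].

Lemma diagP (b n : nat) m : diag b n m ->
  exists q l : nat, [/\ m = (q : int, l : int), (b <= q)%N, (b <= l)%N & (q + l = n)%N].
Proof.
case: m => -[q|q] [l|l] /and3P[/= bq bl /eqP e]; try by exfalso; lia.
by exists q, l; split => //; lia.
Qed.

Lemma diag_nat (b n q l : nat) :
  diag b n (q : int, l : int) = [&& (b <= q)%N, (b <= l)%N & (q + l == n)%N].
Proof. by rewrite /diag /=; lia. Qed.

Lemma diag_in_triangle b n n' m : (n <= n')%N -> diag b n m -> in_triangle n' m.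
Proof. by move=> nn /diagP[q [l [-> ? ? ?]]]; rewrite /in_triangle /=; lia. Qed.

Lemma diag_index b n m : (0 < n)%N -> diag b n m -> index_set m.
Proof. by move=> n0 /diagP[q [l [-> ? ? ?]]]; rewrite /index_set /=; lia. Qed.

Lemma diag_shift1 n m : diag 1 n.+1 (m.1 + 1, m.2) -> diag 0 n m.
Proof. by rewrite /diag /= => /and3P[? ? /eqP ?]; apply/and3P; split; lia. Qed.

Lemma diag_shift2 n m : diag 1 n.+1 (m.1, m.2 + 1) -> diag 0 n m.
Proof. by rewrite /diag /= => /and3P[? ? /eqP ?]; apply/and3P; split; lia. Qed.

Lemma diag_end1 (n : nat) m : (m.1 == 0) && (m.2 == n%:Z) -> diag 0 n m.
Proof. by move=> /andP[/eqP m1 /eqP m2]; rewrite /diag m1 m2 add0r eqxx. Qed.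

Lemma diag_end2 (n : nat) m : (m.1 == n%:Z) && (m.2 == 0) -> diag 0 n m.
Proof. by move=> /andP[/eqP m1 /eqP m2]; rewrite /diag m1 m2 addr0 eqxx. Qed.

Lemma degree0 (k q l : nat) : (q + l = k.+1)%N ->
  (2 * k + 1)%N%:Z + 1 - 2 * (q%:Z + l%:Z) = 0.
Proof. lia. Qed.

Lemma degree1 (k q l : nat) : (q + l = k)%N ->
  (2 * k + 1)%N%:Z - 2 * (q%:Z + l%:Z) = 1.
Proof. lia. Qed.

Lemma degree2 (k q l : nat) : (q + l = k)%N ->
  (2 * k + 1)%N%:Z + 1 - 2 * (q%:Z + l%:Z) = 2.
Proof. lia. Qed.

Lemma degree_bd (k q l : nat) : (q + l = k)%N ->
  (2 * k + 1)%N%:Z - 1 - 2 * (q%:Z + l%:Z) = 0.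
Proof. lia. Qed.

(** * Upper bound: a class that survives at level infinity *)

Section Upper.
Context {R : realType} {g : R -> R} {Omega : set (R * R)}.
Hypothesis gOmega : polar g Omega.
Hypothesis Omega_convex : weakly_convex Omega.
Variables (k j0 : nat) (a : R).
Hypothesis k_gt0 : (0 < k)%N.
Hypothesis j0k : (j0 <= k)%N.
Hypothesis a_gt0 : 0 < a.

Section CurveChain.
Variable s : R.
Hypothesis s_gt1 : 1 < s.
Local Notation Gam := (ray g s).
Local Notation A j l u := (A_form (j : int) (l : int) (Gam u)).
Hypothesis A_j0 : forall u, 0 < u < pi / 2 -> A j0 (k - j0)%N u < a.
Variables tB tA : R.
Hypothesis tB_itv : 0 < tB < pi / 2.
Hypothesis tA_itv : 0 < tA < pi / 2.
(** Near angle 0 only the first coefficient matters, so the second may be raised to k + 1; this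
    bounds at once all forms with first index at most j0 that the chain uses. [A_tA] is the mirror
    image. *)
Hypothesis A_tB : forall u, 0 <= u <= tB -> A j0 k.+1 u < a.
Hypothesis A_tA : forall u, tA <= u <= pi / 2 -> A k.+1 (k - j0)%N u < a.
Variables lo hi : R -> R.
Hypothesis lo_itv : forall e, 0 < e -> 0 < lo e < pi / 2.
Hypothesis hi_itv : forall e, 0 < e -> 0 < hi e < pi / 2.
Hypothesis A_lo : forall e u, 0 < e -> 0 <= u <= lo e -> A 0%N k u < e.
Hypothesis A_hi : forall e u, 0 < e -> hi e <= u <= pi / 2 -> A k 0%N u < e.

Let cG : continuous Gam := continuous_ray gOmega s.
Local Notation point := (curve_point cG).
Local Notation path := (curve_path cG).
Local Notation triangle := (curve_triangle cG).

(* The chain sits at tB in the summands (q, k + 1 - q) with q <= j0, and at tA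
   in the other ones; only the summand (j0, k - j0) requires a path from tB to
   tA, and the paths at both ends leave through the sublevel sets of e. *)
Let node (e : R) (q : nat) : R :=
  if q == 0%N then lo e else if q == k.+1 then hi e
  else if (q <= j0)%N then tB else tA.

Let node_itv e q : 0 < e -> 0 < node e q < pi / 2.
Proof. by move=> e0; rewrite /node; do !case: ifP => _ //; auto. Qed.

Let GamU u : 0 < u < pi / 2 -> open_complement Omega (Gam u).
Proof. by move=> u01; exact: (open_complement_ray gOmega). Qed.

Let A_le (j l n p : nat) u : 0 < u < pi / 2 -> (j <= n)%N -> (l <= p)%N ->
  A j l u <= A n p u.
Proof.
by move=> /GamU[u1 u2 _] jn lp; apply: A_form_mono; rewrite ?lez_nat ?ltW.
Qed.

Let node_level e q : 0 < e -> (0 < q <= k)%N ->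
  sublevel Omega a%:E (q : int, (k.+1 - q)%N : int) (Gam (node e q)).
Proof.
move=> e0 /andP[q0 qk]; split; first exact/GamU/node_itv.
have := node_itv e q e0.
rewrite lte_fin /= /node (gtn_eqF q0) ltn_eqF//.
case: leqP => qj u01.
  apply: le_lt_trans (A_le _ _ j0 k.+1 _ u01 _ _) (A_tB _ _) => //.
    exact: leq_subr.
  by rewrite lexx ltW//; case/andP: u01.
apply: le_lt_trans (A_le _ _ k.+1 (k - j0)%N _ u01 _ _) (A_tA _ _).
- exact: leqW.
- by rewrite -(subSS j0 k) leq_sub2l.
- by rewrite lexx ltW//; case/andP: u01.
Qed.

(** For j < j0 a parameter of the path is at most tB, or else j = 0 and it is at most [lo e]; the
    case j > j0 is symmetric. For j = j0 the whole open arc is below level a. *)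
Let path_level e j u : 0 < e -> e < a -> (j <= k)%N ->
  Num.min (node e j) (node e j.+1) <= u <= Num.max (node e j) (node e j.+1) ->
  sublevel Omega a%:E (j : int, (k - j)%N : int) (Gam u).
Proof.
move=> e0 ea jk uI.
have u01 : 0 < u < pi / 2.
  have /andP[x0 x1] := node_itv e j e0; have /andP[y0 y1] := node_itv e j.+1 e0.
  case/andP: uI => xu uy; apply/andP; split.
    by apply: lt_le_trans xu; rewrite lt_min x0.
  by apply: le_lt_trans uy _; rewrite gt_max x1.
split; first exact: GamU.
have [ul ur] := andP u01.
rewrite lte_fin /=; have [jj|jj|->] := ltngtP j j0; last exact: A_j0.
- have [uB|Bu] := leP u tB.
    apply: le_lt_trans (A_le _ _ j0 k.+1 _ u01 _ _) (A_tB _ _).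
    - exact: ltnW.
    - exact: leqW (leq_subr _ _).
    - by rewrite uB ltW.
  have n1 : node e j.+1 = tB by rewrite /node /= eqSS ltn_eqF ?(leq_trans jj j0k)// jj.
  move: uI; rewrite n1 le_max => /andP[_ /orP[un|]]; last by rewrite leNgt Bu.
  move: un; rewrite /node; case: eqP => [->|/eqP jn0] un.
    by rewrite subn0; apply: lt_trans ea; apply: A_lo => //; rewrite ltW.
  by move: un; rewrite ltn_eqF ?ltnS// (ltnW jj) leNgt Bu.
- have [Au|uA] := leP tA u.
    apply: le_lt_trans (A_le _ _ k.+1 (k - j0)%N _ u01 _ _) (A_tA _ _).
    - exact: leqW.
    - by rewrite leq_sub2l// ltnW.
    - by rewrite Au ltW.
  have n1 : node e j = tA.
    by rewrite /node gtn_eqF ?(leq_ltn_trans _ jj)// ltn_eqF ?ltnS// leqNgt jj.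
  move: uI; rewrite n1 ge_min => /andP[/orP[Au|un] _]; first by rewrite leNgt uA in Au.
  move: un; rewrite /node /= eqSS; case: eqP => [->|/eqP jnk] un.
    by rewrite subnn; apply: lt_trans ea; apply: A_hi => //; rewrite un ltW.
  by move: un; rewrite (leqNgt j.+1) ltnS (ltnW jj)/= leNgt uA.
Qed.

(** The coefficients (q-1)! (l-1)! on points, and q! l! on the paths of [chain1], are chosen so that
    l times q! (l-1)! and q times (q-1)! l! both equal q! l!. *)
Let chain0 e (m : int * int) : sing_chain R :=
  if diag 1 k.+1 m then
    ((absz m.1).-1`! * (absz m.2).-1`!)%N%:R *: point (node e (absz m.1))
  else 0.

Let chain1 e (m : int * int) : sing_chain R :=
  if diag 0 k m then
    ((absz m.1)`! * (absz m.2)`!)%N%:R *: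
      path (node e (absz m.1)) (node e (absz m.1).+1)
  else 0.

Let fam e : chain_family R := fun m => (chain0 e m, chain1 e m).

Let d : int := (2 * k + 1)%N.

Let finite_triangle (x : chain_family R) :
  (forall m, ~~ in_triangle k.+1 m -> x m = 0) -> finite_set [set m | x m <> 0].
Proof.
move=> xm0.
have : finite_set ((fun m : nat * nat => (m.1 : int, m.2 : int)) @` (`I_k.+2 `*` `I_k.+2)).
  by apply: finite_image; apply: finite_setX; exact: finite_II.
apply: sub_finite_set => m /= xm.
have : in_triangle k.+1 m by apply: contrapT => /negP/xm0.
case: m {xm} => -[q|//] [l|]; last by rewrite /in_triangle /= ?andbF.
rewrite /in_triangle /= -PoszD lez_nat => qlk; exists (q, l) => //; split => /=.
  by rewrite ltnS (leq_trans _ qlk)// leq_addr.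
by rewrite ltnS (leq_trans _ qlk)// leq_addl.
Qed.

Let fam_domain e : 0 < e -> e < a -> domain_complex Omega a%:E d (fam e).
Proof.
move=> e0 ea; split.
- apply: finite_triangle => m mI; rewrite /fam /chain0 /chain1 !ifN//.
    by apply: contra mI; exact: diag_in_triangle.
  by apply: contra mI; exact: diag_in_triangle.
- move=> m mI; rewrite /fam /chain0 /chain1 !ifN//.
    by apply: contra mI; exact: diag_index.
  by apply: contra mI; exact: diag_index.
- move=> m mI; rewrite /fam /chain0 /chain1 /=; split.
  + case: ifP => [/diagP[q [l [-> q0 l0 qlk]]]|_]; last exact: chains_in0.
    rewrite degree0//; apply: chains_inZ.
    have -> : l = (k.+1 - q)%N by rewrite -qlk addKn.
    apply: curve_point_in; apply: node_level => //.
    by rewrite q0 -ltnS -qlk -addn1 leq_add2l.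
  + case: ifP => [/diagP[q [l [-> _ _ qlk]]]|_]; last exact: chains_in0.
    rewrite degree1//; apply: chains_inZ.
    have -> : l = (k - q)%N by rewrite -qlk addKn.
    apply: curve_path_in => w; apply: path_level => //.
    by rewrite -qlk leq_addr.
Qed.

Let sgn_d : (-1) ^ d = -1 :> rat.
Proof. by rewrite /d -exprnP addn1 exprS mulnC exprM sqrr_sign mulr1. Qed.

(** The ends of each path cancel against the neighbouring points. At q = 0 and l = 0 the coefficient
    of the neighbour is 0, so the outer ends [lo e] and [hi e] remain. *)
Let bd_fam e m : index_set m -> bd d (fam e) m = (0,
  if (m.1 == 0) && (m.2 == k) then - (k`!%:R *: point (lo e))
  else if (m.1 == k) && (m.2 == 0) then k`!%:R *: point (hi e) else 0).
Proof.
move=> mI; rewrite /bd mI /fam /=; congr pair.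
  by rewrite /chain0; case: ifP => _; rewrite ?sing_bdZ ?bd_curve_point ?scaler0 ?sing_bd0.
rewrite sgn_d scaleN1r.
have [mk|mk] := boolP (diag 0 k m); last first.
  rewrite (negbTE (contra (@diag_end1 k m) mk)) (negbTE (contra (@diag_end2 k m) mk)).
  rewrite /chain1 (negbTE mk) /chain0.
  rewrite (negbTE (contra (@diag_shift1 k m) mk)) (negbTE (contra (@diag_shift2 k m) mk)).
  by rewrite !scaler0 subrr subr0 sing_bd0.
have [q [l [mE _ _ qlk]]] := diagP _ _ _ mk.
rewrite mE /= in mk mI *.
have -> : chain1 e (q : int, l : int) = (q`! * l`!)%N%:R *: path (node e q) (node e q.+1).
  by rewrite /chain1 mk.
rewrite sing_bdZ bd_curve_path.
have -> : l%:~R *: chain0 e (q%:Z + 1, l : int) =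
    if l == 0%N then 0 else (q`! * l`!)%N%:R *: point (node e q.+1).
  rewrite -PoszD addn1 /chain0 diag_nat /=.
  case: l qlk {mI mk mE} => [|l] qlk; first by rewrite scale0r.
  by rewrite addSn qlk eqxx /= scalerA -pmulrn -natrM factS mulnCA.
have -> : q%:~R *: chain0 e (q : int, l%:Z + 1) =
    if q == 0%N then 0 else (q`! * l`!)%N%:R *: point (node e q).
  rewrite -PoszD addn1 /chain0 diag_nat /=.
  case: q qlk {mI mk mE} => [|q] qlk; first by rewrite scale0r.
  by rewrite addnS qlk eqxx /= scalerA -pmulrn -natrM factS mulnA.
rewrite scalerBr !eqz_nat.
have [q0|q0] := eqVneq q 0%N.
  have lk : l = k by rewrite -qlk q0.
  rewrite q0 lk eqxx /= gtn_eqF// subr0 addrAC subrr add0r.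
  by rewrite /node eqxx mul1n.
rewrite /=; have [l0|l0] := eqVneq l 0%N.
  have qk : q = k by rewrite -qlk l0 addn0.
  rewrite l0 qk eqxx /= sub0r opprK subrK.
  by rewrite /node /= eqxx muln1.
by rewrite andbF subrr.
Qed.

Let fam_cycle e : 0 < e -> e < a -> rel_cycles Omega e%:E a%:E d (fam e).
Proof.
move=> e0 ea; have De := fam_domain e e0 ea; split => //; split.
- by apply: bd_finite; case: De.
- by move=> m /negbTE mI; rewrite /bd mI.
- move=> m mI; rewrite bd_fam//=; split; first exact: chains_in0.
  have [/andP[/eqP m1 /eqP m2]|_] := ifPn.
    rewrite m1 m2 (degree_bd k 0 k)//; apply: chains_inN; apply: chains_inZ.
    apply: curve_point_in; split; first by apply: GamU; exact: lo_itv.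
    by rewrite m1 m2 lte_fin A_lo// lexx ltW//; have /andP[] := lo_itv e e0.
  have [/andP[/eqP m1 /eqP m2]|_] := ifPn; last exact: chains_in0.
  rewrite m1 m2 (degree_bd k k 0) ?addn0//; apply: chains_inZ.
  apply: curve_point_in; split; first by apply: GamU; exact: hi_itv.
  by rewrite m1 m2 lte_fin A_hi// lexx ltW//; have /andP[] := hi_itv e e0.
Qed.

(** The two families differ only in their outer paths. A triangle with vertices [lo e], [lo e'] and
    the first node trades the difference for a path from [lo e] to [lo e'], inside the sublevel set
    of e'; likewise at the other end. *)
Let fam_compatible e e' : 0 < e -> e <= e' -> e' < a ->
  rel_boundaries Omega e'%:E a%:E d (fam e - fam e').
Proof.
move=> e0 ee' e'a; have e'0 := lt_le_trans e0 ee'; have ea := le_lt_trans ee' e'a.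
have Dee' : domain_complex Omega a%:E d (fam e - fam e').
  by apply: domainD; [|apply: domainN]; exact: fam_domain.
split => //.
pose y1 (m : int * int) : sing_chain R :=
  if (m.1 == 0) && (m.2 == k) then - (k`!%:R *: triangle (lo e) (lo e') (node e 1))
  else if (m.1 == k) && (m.2 == 0) then k`!%:R *: triangle (node e k) (hi e) (hi e')
  else 0.
have node_eq q : (0 < q <= k)%N -> node e q = node e' q.
  by move=> /andP[q0 qk]; rewrite /node gtn_eqF// ltn_eqF// ltnS.
pose y : chain_family R := fun m => (0, y1 m).
have bdy m : index_set m -> bd (d + 1) y m = (0, sing_bd (y1 m)).
  by move=> mI; rewrite /bd mI /= sing_bd0 !scaler0 subrr scaler0 addr0.
have y1_diag m : ~~ diag 0 k m -> y m = 0.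
  move=> mk; rewrite /y /y1.
  by rewrite (negbTE (contra (@diag_end1 k m) mk)) (negbTE (contra (@diag_end2 k m) mk)).
have fy : finite_set [set m | y m <> 0].
  apply: finite_triangle => m mI; apply: y1_diag.
  by apply: contra mI; exact: diag_in_triangle.
exists y.
  split => //.
    move=> m mI; apply: y1_diag; apply: contra mI; exact: diag_index.
  move=> m mI /=; split; first exact: chains_in0.
  rewrite /y1; have [/andP[/eqP m1 /eqP m2]|_] := ifPn.
    apply: chains_inN; apply: chains_inZ.
    rewrite [X in chains_in _ X](_ : _ = 2); last by rewrite m1 m2 (degree2 k 0 k).
    apply: (@curve_triangle_in _ _ cG _ (Num.min (lo e) (Num.min (lo e') (node e 1)))
      (Num.max (lo e) (Num.max (lo e') (node e 1)))); rewrite ?ge_min ?le_max ?lexx ?orbT//.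
    move=> w /andP[]; rewrite ge_min ge_min le_max le_max => wl wr.
    have [l0 l1] := andP (lo_itv e e0); have [l0' l1'] := andP (lo_itv e' e'0).
    have [n0 n1] := andP (node_itv e 1 e0).
    have w01 : 0 < w < pi / 2.
      by apply/andP; split; [case/or3P: wl|case/or3P: wr]; lra.
    have w0 : 0 <= w by case/andP: w01 => /ltW.
    have [wlo|low] := leP w (lo e).
      split; first exact: GamU.
      by rewrite m1 m2 lte_fin (lt_trans _ ea)// A_lo// w0.
    have [wlo'|low'] := leP w (lo e').
      split; first exact: GamU.
      by rewrite m1 m2 lte_fin (lt_trans _ e'a)// A_lo// w0.
    have mE : m = (0%N : int, (k - 0)%N : int) by rewrite subn0 [LHS]surjective_pairing m1 m2.
    rewrite mE; apply: (path_level e) => //.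
    rewrite [node e 0]/node/= ge_min le_max (ltW low)/=.
    by move: wr; rewrite leNgt low/= leNgt low'/= => ->.
  have [/andP[/eqP m1 /eqP m2]|_] := ifPn; last exact: chains_in0.
  apply: chains_inZ.
  rewrite [X in chains_in _ X](_ : _ = 2); last by rewrite m1 m2 (degree2 k k 0) ?addn0.
  apply: (@curve_triangle_in _ _ cG _ (Num.min (node e k) (Num.min (hi e) (hi e')))
    (Num.max (node e k) (Num.max (hi e) (hi e')))); rewrite ?ge_min ?le_max ?lexx ?orbT//.
  move=> w /andP[]; rewrite ge_min ge_min le_max le_max => wl wr.
  have [l0 l1] := andP (hi_itv e e0); have [l0' l1'] := andP (hi_itv e' e'0).
  have [n0 n1] := andP (node_itv e k e0).
  have w01 : 0 < w < pi / 2.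
    by apply/andP; split; [case/or3P: wl|case/or3P: wr]; lra.
  have w1 : w <= pi / 2 by case/andP: w01 => _ /ltW.
  have [wlo|low] := leP (hi e) w.
    split; first exact: GamU.
    by rewrite m1 m2 lte_fin (lt_trans _ ea)// A_hi// wlo.
  have [wlo'|low'] := leP (hi e') w.
    split; first exact: GamU.
    by rewrite m1 m2 lte_fin (lt_trans _ e'a)// A_hi// wlo'.
  have mE : m = (k : int, (k - k)%N : int) by rewrite subnn [LHS]surjective_pairing m1 m2.
  rewrite mE; apply: (path_level e) => //.
  rewrite [node e k.+1]/node eqxx /= ge_min le_max (ltW low) orbT andbT.
  by move: wl; rewrite (leNgt (hi e)) low (leNgt (hi e')) low' !orbF => ->.
split.
- have [fx _ _] := Dee'.
  have : finite_set ([set m | (fam e - fam e') m <> 0] `|` [set m | bd (d + 1) y m <> 0]).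
    by rewrite finite_setU; split => //; apply: bd_finite.
  apply: sub_finite_set => m /= xym.
  have [xm|] := pselect ((fam e - fam e') m = 0); last by left.
  right => ym; apply: xym; rewrite chain_familyD chain_familyN xm ym /=.
  by rewrite subr0.
- move=> m mI; have [_ x0 _] := Dee'.
  by rewrite chain_familyD chain_familyN x0// /bd (negbTE mI) /= subr0.
move=> m mI; rewrite chain_familyD chain_familyN bdy// chain_familyD chain_familyN.
rewrite subr0; split.
  rewrite [X in chains_in _ _ X](_ : _ = 0); first exact: chains_in0.
  apply/eqP; rewrite subr_eq0; apply/eqP; rewrite /= /chain0.
  case: ifP => // /diagP[q [l [-> q0 l0 qlk]]] /=.
  by rewrite node_eq// q0 -ltnS -qlk -addn1 leq_add2l.
rewrite /= /y1; have [/andP[/eqP m1 /eqP m2]|m0k] := ifPn.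
  have mE f : chain1 f m = k`!%:R *: path (lo f) (node f 1).
    rewrite /chain1 ifT; last by apply: diag_end1; rewrite m1 m2 !eqxx.
    by rewrite m1 m2 /= mul1n.
  have n1 : node e' 1 = node e 1 by rewrite node_eq// k_gt0.
  rewrite !mE n1 sing_bdN sing_bdZ opprK -scalerBr -scalerDr bd_curve_triangle.
  rewrite [X in _ *: X](_ : _ = path (lo e) (lo e')); last first.
    exact: addrB_cancel.
  apply: chains_inZ.
  rewrite [X in chains_in _ X](_ : _ = 1); last by rewrite m1 m2 (degree1 k 0 k).
  apply: curve_path_in => w /andP[]; rewrite ge_min le_max => wl wr.
  have [l0 l1] := andP (lo_itv e e0); have [l0' l1'] := andP (lo_itv e' e'0).
  have w01 : 0 < w < pi / 2.
    by apply/andP; split; [case/orP: wl|case/orP: wr]; lra.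
  have w0 : 0 <= w by case/andP: w01 => /ltW.
  split; first exact: GamU.
  rewrite m1 m2 lte_fin; case/orP: wr => wr; last by rewrite A_lo// w0.
  by apply: lt_le_trans ee'; rewrite A_lo// w0.
have [/andP[/eqP m1 /eqP m2]|mk0] := ifPn.
  have mE f : chain1 f m = k`!%:R *: path (node f k) (hi f).
    rewrite /chain1 ifT; last by apply: diag_end2; rewrite m1 m2 !eqxx.
    by rewrite m1 m2 /= muln1 [node f k.+1]/node eqxx.
  have n1 : node e' k = node e k by rewrite node_eq// k_gt0 leqnn.
  rewrite !mE n1 sing_bdZ -!scalerBr bd_curve_triangle.
  rewrite [X in _ *: X](_ : _ = - path (hi e) (hi e')); last first.
    exact: subrB_cancel.
  apply: chains_inZ; apply: chains_inN.
  rewrite [X in chains_in _ X](_ : _ = 1); last by rewrite m1 m2 (degree1 k k 0) ?addn0.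
  apply: curve_path_in => w /andP[]; rewrite ge_min le_max => wl wr.
  have [l0 l1] := andP (hi_itv e e0); have [l0' l1'] := andP (hi_itv e' e'0).
  have w01 : 0 < w < pi / 2.
    by apply/andP; split; [case/orP: wl|case/orP: wr]; lra.
  have w1 : w <= pi / 2 by case/andP: w01 => _ /ltW.
  split; first exact: GamU.
  rewrite m1 m2 lte_fin; case/orP: wl => wl; last by rewrite A_hi// wl.
  by apply: lt_le_trans ee'; rewrite A_hi// wl.
rewrite sing_bd0 subr0 [X in chains_in _ _ X](_ : _ = 0); first exact: chains_in0.
apply/eqP; rewrite subr_eq0; apply/eqP; rewrite /chain1.
case: ifP => // /diagP[q [l [mE _ _ qlk]]].
rewrite mE /= !eqz_nat in m0k mk0 *.
have q0 : q != 0%N.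
  by apply: contra m0k => /eqP q0; move: qlk; rewrite q0 add0n => ->; rewrite !eqxx.
have qk : q != k.
  apply: contra mk0 => /eqP qk; rewrite qk eqxx /=.
  by move: qlk => /eqP; rewrite qk -[X in _ == X]addn0 eqn_add2l.
have qk' : (q <= k)%N by rewrite -qlk leq_addr.
by rewrite !node_eq// ?lt0n ?q0 ?qk'// ltn_neqAle qk.
Qed.

(** For e <= [corner] the sublevel set at (1, k) is empty. If the family were a relative boundary,
    its component there, a point with coefficient (k-1)!, would be a genuine boundary and have
    weight 0. *)
Lemma curve_chain_nonzero : natural_map_nonzero Omega a d.
Proof.
have c0 := corner_gt0 gOmega.
exists (fun e => hclass Omega e%:E a%:E d (fam e)).
  split => [e e0|e e' e0 ee']; rewrite lte_fin => ea.
    by exists (fam e) => //; exact: fam_cycle.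
  rewrite hmap_hclass//; apply: hclass_eq.
  exact: fam_compatible.
pose e := Num.min (corner g) (a / 2).
have e0 : 0 < e by rewrite lt_min c0 divr_gt0.
have ec : e <= corner g by rewrite ge_min lexx.
have ea2 : e <= a / 2 by rewrite ge_min lexx orbT.
exists e; split => //; rewrite /natural_map min_l// hmap_hclass ?leey//.
move=> /(congr1 (@^~ (fam e))) E.
have : hclass Omega e%:E +oo%E d 0 (fam e) by rewrite -E; exact: hclass_refl.
rewrite /hclass/= subr0 => -[_ [y Dy [_ _ zC]]].
pose m : int * int := (1, k : int).
have mI : index_set m by [].
have [] := zC m mI; rewrite chain_familyD chain_familyN /bd mI /=.
rewrite (sublevel_empty gOmega Omega_convex _ _ ec) //= => /chains_in_set0/eqP.
rewrite subr_eq0 => /eqP /(congr1 (weight (cst 1))).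
rewrite weight_bd// /chain0 diag_nat /= k_gt0 add1n eqxx.
rewrite /weight fgliftZ -/(weight _ _) weight_curve_point /= => /eqP.
by rewrite [_ *: _]mulr1 pnatr_eq0 gtn_eqF// muln_gt0 !fact_gt0.
Qed.

End CurveChain.
End Upper.

(** * The two bounds combined *)

Lemma natural_map_nonzero_gt {R : realType} {g : R -> R} {Omega : set (R * R)}
    (gOmega : polar g Omega) (Omega_convex : weakly_convex Omega)
    (k j0 : nat) (a M : R) : (0 < k)%N -> (j0 <= k)%N ->
  (forall q, Omega q -> A_form j0 (k - j0)%N q <= M) -> M < a ->
  natural_map_nonzero Omega a (2 * k + 1)%:Z.
Proof.
move=> k0 j0k OM Ma; have [cg g0 _] := gOmega.
have pi2_gt0 : 0 < pi / 2 :> R by rewrite divr_gt0 ?pi_gt0.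
have M0 : 0 <= M.
  have := OM (0, 0); rewrite /A_form /= !mulr0 addr0; apply.
  by apply: (Omega_e1 gOmega); rewrite lexx ltW// g0// lexx ltW.
have a0 : 0 < a by exact: le_lt_trans Ma.
(* Any s > 1 with s * M < a serves; M + 1 keeps the denominator positive when M = 0. *)
pose s := 1 + (a - M) / (2 * (M + 1)).
have s1 : 1 < s by rewrite ltrDl divr_gt0// ?subr_gt0//; lra.
have sM : s * M < a.
  rewrite /s mulrDl mul1r -ltrBrDl mulrAC ltr_pdivrMr; last by lra.
  by rewrite ltr_pM2l ?subr_gt0//; lra.
have A_j0 u : 0 <= u <= pi / 2 -> A_form j0 (k - j0)%N (ray g s u) < a.
  move=> u01; apply: le_lt_trans sM.
  rewrite -[s in ray g s u]mulr1 ray_scale A_form_scale ler_wpM2l//; first by lra.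
  by apply: OM; apply: (ray_in gOmega) => //; rewrite ler01 lexx.
have cA (m1 m2 : int) := continuous_A_ray gOmega m1 m2 s.
have A0 (j l : int) : A_form j l (ray g s 0) = j%:~R * (s * g 0).
  by rewrite /A_form /ray /= cos0 sin0 !mulr0 addr0 mulr1.
have Api (j l : int) : A_form j l (ray g s (pi / 2)) = l%:~R * (s * g (pi / 2)).
  by rewrite /A_form /ray /= cos_pihalf sin_pihalf !mulr0 add0r mulr1.
have [tB tB_itv A_tB] : exists2 x : R, 0 < x < pi / 2 &
    forall u, 0 <= u <= x -> A_form j0 k.+1 (ray g s u) < a.
  apply: near0_lt; first exact: cA.
  by rewrite A0 -(A0 _ (k - j0)%N) A_j0// lexx ltW.
have [tA tA_itv A_tA] : exists2 x : R, 0 < x < pi / 2 &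
    forall u, x <= u <= pi / 2 -> A_form k.+1 (k - j0)%N (ray g s u) < a.
  apply: near_pi2_lt; first exact: cA.
  by rewrite Api -(Api j0) A_j0// lexx ltW.
have /choice[lo loP] : forall e : R, exists x : R, 0 < e -> 0 < x < pi / 2 /\
    forall u, 0 <= u <= x -> A_form 0 k (ray g s u) < e.
  move=> e; have [e0|e0] := ltP 0 e; last by exists 0.
  have [|x x01 xP] := near0_lt _ e (cA 0 k); first by rewrite A0 mul0r.
  by exists x.
have /choice[hi hiP] : forall e : R, exists x : R, 0 < e -> 0 < x < pi / 2 /\
    forall u, x <= u <= pi / 2 -> A_form k 0 (ray g s u) < e.
  move=> e; have [e0|e0] := ltP 0 e; last by exists 0.
  have [|x x01 xP] := near_pi2_lt _ e (cA k 0); first by rewrite Api mul0r.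
  by exists x.
apply: (curve_chain_nonzero gOmega Omega_convex k j0 a k0 j0k a0 s s1 _
  tB tA tB_itv tA_itv A_tB A_tA lo hi).
- by move=> u /andP[u0 u1]; apply: A_j0; rewrite !ltW.
- by move=> e e0; case: (loP e e0).
- by move=> e e0; case: (hiP e e0).
- by move=> e u e0; case: (loP e e0) => _; exact.
- by move=> e u e0; case: (hiP e e0) => _; exact.
Qed.

Theorem proposition3p5 (R : realType) (Omega : set (R * R))
    (Omega_star : star_domain Omega) (Omega_convex : weakly_convex Omega)
    (k : nat) (k_gt0 : (1 <= k)%N) :
  exists M : nat -> R,
    (forall j : nat, (j <= k)%N ->
       is_max [set A_form j (k - j)%N p | p in Omega] (M j)) /\
    capacity Omega k = (\big[Num.min/M 0%N]_(j < k.+1) M j)%:E.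
Proof.
have [g gOmega] := star_polar _ Omega_star.
have /choice[p pP] : forall j : nat, exists p, Omega p /\
    forall q, Omega q -> A_form j (k - j)%N q <= A_form j (k - j)%N p.
  by move=> j; have [p Op pmax] := max_A_form gOmega j (k - j); exists p.
exists (fun j : nat => A_form j (k - j)%N (p j)); split.
  move=> j _; have [Op pmax] := pP j; split; first by exists (p j).
  by move=> _ [q Oq <-]; exact: pmax.
set M := fun j : nat => A_form j (k - j)%N (p j).
set mu := \big[_/_]_(_ < _) _.
apply/eqP; rewrite eq_le; apply/andP; split; last first.
  (* A qualifying level below the minimum would be below the maximum for every j, against
     [natural_map_zero]. *)
  apply/ereal_infP => _ [a [a0 na] <-]; rewrite lee_fin leNgt; apply/negP => amu.
  apply: (natural_map_zero gOmega Omega_convex k a k_gt0 a0 _ na) => j jk.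
  exists (p j); first exact: (proj1 (pP j)).
  have jk' : (j < k.+1)%N by [].
  exact: le_trans (ltW amu) (bigmin_le (M 0%N) (Ordinal jk') (fun i => M i)).
have [j0 j0k Mj0] : exists2 j, (j <= k)%N & M j <= mu.
  have /bigmin_leP[M0|[i _ Mi]] : mu <= mu by []; first by exists 0%N.
  by exists i => //; rewrite -ltnS.
(* Every level mu + e with e > 0 exceeds the maximum for j0, hence qualifies. *)
apply/lee_addgt0Pr => e e0; rewrite -EFinD.
have mue : M j0 < mu + e by apply: le_lt_trans Mj0 _; rewrite ltrDl.
apply: ge_ereal_inf; exists (mu + e)%:E => //; exists (mu + e) => //; split.
  apply: le_lt_trans mue.
  have [p1 p2] := Omega_ge0 gOmega _ (proj1 (pP j0)).
  by rewrite /M /A_form -!pmulrn addr_ge0// mulr_ge0.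
exact: (natural_map_nonzero_gt gOmega Omega_convex k j0 _ (M j0) k_gt0 j0k
  (proj2 (pP j0)) mue).
Qed.
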